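(* Let $F$ be an algebraically closed field of characteristic $p>2$, let $s\geq 1$ be an integer, and put $m=sp-1$. Let $\mathcal{X}$ be the hyperelliptic curve over $F$ given by the affine equation $y^2=x^m+1$. Then: (1) if $s=2k+1$ with $k\geq 0$ an integer, the $a$-number of $\mathcal{X}$ equals $\dfrac{k(p-1)}{2}$; (2) if $s=2k$ with $k\geq 1$ an integer, the $a$-number of $\mathcal{X}$ equals $\dfrac{k(p-1)}{2}$.
   Context: The curve $\mathcal{X}$ given by an affine equation $y^2=f(x)$, with $f$ a polynomial without multiple roots, means the nonsingular projective curve over $F$ with function field $F(x,y)$, $y^2=f(x)$. The $a$-number $a(\mathcal{X})$ of a nonsingular, projective, irreducible curve $\mathcal{X}$ over $F$ is the $a$-number of its Jacobian $\mathcal{J}_{\mathcal{X}}$, i.e. the dimension over $F$ of $\mathrm{Hom}(\alpha_p,\mathcal{J}_{\mathcal{X}})$, where $\alpha_p$ is the group scheme $\mathrm{Spec}(F[X]/(X^p))$ with co-multiplication $X\mapsto 1\otimes X+X\otimes 1$. Equivalently, $a(\mathcal{X})$ is the dimension of the $F$-vector space of exact holomorphic differentials on $\mathcal{X}$, i.e. the dimension of the kernel of the Cartier operator $\mathscr{C}$ on $H^0(\mathcal{X},\Omega^1)$. Here, for a separating variable $x$ of the function field $K$ of $\mathcal{X}$, every differential can be written $\omega=(f_0^p+f_1^px+\cdots+f_{p-1}^px^{p-1})dx$ with $f_i\in K$, and $\mathscr{C}(\omega)=f_{p-1}dx$ (independent of the choice of $x$). *)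

(* Defs.v *)
From HB Require Import structures.
From mathcomp Require Import all_boot all_order all_algebra all_field.

Set Implicit Arguments.
Unset Strict Implicit.
Unset Printing Implicit Defensive.

Import Order.TTheory GRing.Theory Num.Theory.
Local Open Scope ring_scope.

(* A curve over F with a chosen nonconstant function x is given by its        *)
(* function field K, a finite extension of the rational function field F(x),  *)
(* which is {fraction {poly F}}.                                              *)

Definition coordx (F : fieldType) (K : fieldExtType {fraction {poly F}}) : K :=
  (FracField.tofrac ('X : {poly F}))%:A.

Definition constK (F : fieldType) (K : fieldExtType {fraction {poly F}})
    (c : F) : K :=
  (FracField.tofrac c%:P)%:A.

(* K = F(x, y) with y^2 = f(x). *)
Definition is_sqrt_function_field (F : fieldType) (f : {poly F})
    (K : fieldExtType {fraction {poly F}}) (y : K) : Prop :=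
  y ^+ 2 = (FracField.tofrac f)%:A /\ <<1; y>>%VS = fullv.

Section FunctionField.

Variables (F : fieldType) (K : fieldExtType {fraction {poly F}}).

Definition is_derivation (M : lmodType K) (D : K -> M) : Prop :=
  [/\ forall a b, D (a + b) = D a + D b,
      forall a b, D (a * b) = a *: D b + b *: D a
    & forall c : F, D (constK K c) = 0].

(* (Omega, d) is the module of Kaehler differentials of K over F (not over    *)
(* the base field F(x) of the extension type), by its universal property.     *)
Definition is_kahler (Omega : lmodType K) (d : K -> Omega) : Prop :=
  is_derivation d /\
  forall (M : lmodType K) (D : K -> M), is_derivation D ->
    exists h : {linear Omega -> M},
      (forall a, h (d a) = D a) /\
      (forall h' : {linear Omega -> M}, (forall a, h' (d a) = D a) -> h' =1 h).

(* Places of K over F, as normalized discrete valuations trivial on F. The    *)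
(* value v 0, which should be +oo, is irrelevant and left unconstrained.      *)
Definition is_place (v : K -> int) : Prop :=
  [/\ forall a b, a != 0 -> b != 0 -> v (a * b) = v a + v b,
      forall a b, a != 0 -> b != 0 -> a + b != 0 ->
        Num.min (v a) (v b) <= v (a + b),
      forall c : F, c != 0 -> v (constK K c) = 0
    & exists2 t, t != 0 & v t = 1].

Variables (Omega : lmodType K) (d : K -> Omega).

Definition regular_at (v : K -> int) (w : Omega) : Prop :=
  exists t g : K,
    [/\ t != 0, v t = 1, g = 0 \/ 0 <= v g & w = g *: d t].

Definition holomorphic (w : Omega) : Prop :=
  forall v : K -> int, is_place v -> regular_at v w.

(* Graph of the Cartier operator, computed with the variable t, which is      *)
(* meant to be separating.                                                    *)
Definition cartier (p : nat) (t : K) (w w' : Omega) : Prop :=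
  exists f : nat -> K,
    w = (\sum_(0 <= i < p) f i ^+ p * t ^+ i) *: d t /\ w' = f p.-1 *: d t.

(* V is an F-subspace of Omega, of dimension n. Omega itself has infinite     *)
(* dimension over F, hence the explicit basis.                                *)
Definition has_dimF (V : Omega -> Prop) (n : nat) : Prop :=
  exists b : 'I_n -> Omega,
    (forall c : 'I_n -> F,
       \sum_(i < n) constK K (c i) *: b i = 0 -> forall i, c i = 0) /\
    (forall w, V w <->
       exists c : 'I_n -> F, w = \sum_(i < n) constK K (c i) *: b i).

(* The curve has a-number n: the kernel of the Cartier operator on the space  *)
(* of holomorphic differentials has dimension n over F. Here p is the         *)
(* characteristic of F, and K is assumed to be separable over F(x).           *)
Definition a_number_is (p n : nat) : Prop :=
  has_dimF (fun w => holomorphic w /\ cartier p (coordx K) w 0) n.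

End FunctionField.

(* Main.v *)
Require Import Defs.
From HB Require Import structures.
From mathcomp Require Import all_boot all_order all_algebra all_field.
From mathcomp Require Import zify ring.
From Stdlib Require Import IndefiniteDescription.

(** Put m = s p - 1, f = X ^ m + 1, p = 2 q + 1 and n = ceil (m / 2), so that
    the curve y ^ 2 = f(x) has genus n - 1.

    The holomorphic differentials are the h(x) dx / y with deg h <= n - 2.
    That these have no pole needs no description of the places: if x is
    integral at a place then so is y, and f + x f' = 1 gives
    dx / y = y dx + 2 x dy, where the differential of an integral function has
    no pole [d_integral]; if x is not integral, the same works for z = 1 / x
    and eta = y / x ^ n, which satisfy an equation of the same shape
    [form_holomorphic]. Conversely, a differential (P + Q y) / (R y) dx without
    poles is tested at the points (c, y0) and (c, - y0) for every zero c of R;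
    both tests together force P(c) = Q(c) = 0, and where the two points
    coincide, the ramification there makes up for the missing test
    [holomorphic_numerator_root]. Cancelling zeros makes R constant, and the
    same test in the chart (z, eta) at z = 0 gives Q = 0 and deg P <= n - 2
    [holomorphic_form].

    The tool behind all statements on differentials is the p-basis. If t has
    value 1 at a place then the terms a_i ^ p t ^ i with 0 <= i < p have
    distinct values modulo p, so no cancellation occurs between them
    [vge_peval]; hence 1, t, ..., t ^ (p - 1) is a basis over the subfield of
    p-th powers, integral functions have integral coordinates, and
    differentiating termwise preserves integrality. The same kind of basis
    yields a derivation that does not kill x [p_basis_derivation], and through
    the universal property of Kaehler differentials dx <> 0.

    As h / y = h f ^ q / y ^ p, the Cartier operator kills h(x) dx / y exactly
    when the coefficients of h f ^ q at the exponents congruent to - 1 modulo p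
    vanish [cartier_kernelP]. For this f, each of these coefficients is zero or
    a nonzero binomial coefficient times a single h_i with (i + 1) mod p <= q,
    and every such h_i occurs [coef_binomial_power].
      The a-number is therefore the number of
    indices 1 <= i <= n - 1 with i mod p > q, and both parities of s give
    k q [count_residues]. *)

Set Implicit Arguments.
Unset Strict Implicit.
Unset Printing Implicit Defensive.

Import Order.TTheory GRing.Theory Num.Theory.
Local Open Scope ring_scope.

(** * Bases over the subfield of p-th powers *)

Section PBasis.

Variables (K : fieldType) (p : nat).
Hypothesis charK : p \in [pchar K].

Let p_pr : prime p := pcharf_prime charK.
Let p_gt0 : (0 < p)%N := prime_gt0 p_pr.

Local Notation Frob := (pFrobenius_aut charK).

(** Coordinates over the subfield of p-th powers are packed into a polynomial
    whose coefficients get raised to the power p, so that polynomial arithmetic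
    applies to them. *)
Definition peval (t : K) (Q : {poly K}) : K := (map_poly Frob Q).[t].

Definition p_spans (t : K) :=
  forall u, exists2 Q : {poly K}, (size Q <= p)%N & u = peval t Q.

Definition p_free (t : K) :=
  forall Q : {poly K}, (size Q <= p)%N -> peval t Q = 0 -> Q = 0.

Lemma pevalE t (Q : {poly K}) n : (size Q <= n)%N ->
  peval t Q = \sum_(i < n) Q`_i ^+ p * t ^+ i.
Proof.
move=> szQ; rewrite /peval (horner_coef_wide _ (n := n)); last first.
  by apply: leq_trans (size_poly _ _) _.
by apply: eq_bigr => i _; rewrite coef_map.
Qed.

Lemma pevalD t P Q : peval t (P + Q) = peval t P + peval t Q.
Proof. by rewrite /peval rmorphD hornerD. Qed.

Lemma pevalB t P Q : peval t (P - Q) = peval t P - peval t Q.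
Proof. by rewrite /peval rmorphB hornerD hornerN. Qed.

Lemma pevalZ t c Q : peval t (c *: Q) = c ^+ p * peval t Q.
Proof. by rewrite /peval map_polyZ hornerZ. Qed.

Lemma pevalM t P Q : peval t (P * Q) = peval t P * peval t Q.
Proof. by rewrite /peval rmorphM hornerM. Qed.

Lemma pevalX t : peval t 'X = t.
Proof. by rewrite /peval map_polyX hornerX. Qed.

Lemma pevalC t c : peval t c%:P = c ^+ p.
Proof. by rewrite /peval map_polyC hornerC. Qed.

(** Reduction modulo the polynomial 'X^p - t ^+ p, which vanishes at t, makes
    the powers of t from the p-th on superfluous. *)
Lemma peval_mod t Q : exists A B : {poly K},
  [/\ (size B <= p)%N, Q = A * ('X^p - t%:P) + B & peval t B = peval t Q].
Proof.
have M0 : peval t ('X^p - t%:P) = 0.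
  by rewrite pevalB pevalC /peval map_polyXn hornerXn subrr.
have sM : size ('X^p - t%:P : {poly K}) = p.+1 by rewrite size_XnsubC.
have mM : 'X^p - t%:P != 0 :> {poly K} by rewrite -size_poly_eq0 sM.
exists (Q %/ ('X^p - t%:P)), (Q %% ('X^p - t%:P)); split.
- by rewrite -ltnS -sM ltn_modp.
- exact: divp_eq.
- by rewrite [in RHS](divp_eq Q ('X^p - t%:P)) pevalD pevalM M0 mulr0 add0r.
Qed.

(** Frobenius turns linear algebra over the subfield of p-th powers into
    linear algebra over the field itself: writing the powers of t on those
    of x with the p-th powers of the entries of a matrix, freeness of the
    powers of t makes this matrix invertible. *)
Lemma p_basis_exchange x t : p_spans x -> p_free t -> p_spans t.
Proof.
move=> spx frt.
have /fin_all_exists [q qP] : forall j : 'I_p, exists Q : {poly K},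
    (size Q <= p)%N /\ t ^+ j = peval x Q.
  by move=> j; have [Q sQ e] := spx (t ^+ j); exists Q.
pose A := \matrix_(j < p) poly_rV (q j) : 'M[K]_p.
have AE (c : 'rV[K]_p) : peval t (rVpoly c) = peval x (rVpoly (c *m A)).
  rewrite !(@pevalE _ _ p) ?size_poly //.
  transitivity (\sum_(j < p) \sum_(i < p)
      (c 0 j * A j i) ^+ p * x ^+ i).
    apply: eq_bigr => j _; rewrite coef_rVpoly_ord (qP j).2.
    rewrite (@pevalE _ _ p) ?(qP j).1 // mulr_sumr; apply: eq_bigr => i _.
    by rewrite exprMn !mxE mulrA.
  rewrite exchange_big; apply: eq_bigr => i _ /=.
  rewrite -mulr_suml coef_rVpoly_ord !mxE; congr (_ * _).
  by rewrite -(pFrobenius_autE charK) rmorph_sum.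
have Au : A \in unitmx.
  rewrite -row_free_unit; apply: inj_row_free => c cA0.
  have c0 : rVpoly c = 0.
    apply: frt; first exact: size_poly.
    by rewrite AE cA0 raddf0 /peval map_poly0 horner0.
  by rewrite -(rVpolyK c) c0 raddf0.
move=> u; have [Q sQ ->] := spx u.
exists (rVpoly (poly_rV Q *m invmx A)); first exact: size_poly.
by rewrite AE mulmxKV // poly_rV_K.
Qed.

(** Over a p-basis x, the derivative with respect to x can be read off any
    expression of an element as a polynomial in x with p-th powers as
    coefficients: two such expressions differ by a multiple of
    'X^p - x ^+ p, whose derivative is zero. *)
Lemma p_basis_derivation x : p_spans x -> p_free x ->
  exists D : K -> K, [/\ D x = 1,
    forall a b, D (a + b) = D a + D b,
    forall a b, D (a * b) = a * D b + b * D a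
  & forall a, D (a ^+ p) = 0].
Proof.
move=> spx frx; pose der Q := ((map_poly Frob Q)^`()).[x].
have derD P Q : der (P + Q) = der P + der Q.
  by rewrite /der rmorphD derivD hornerD.
have derM P Q : der (P * Q) = peval x P * der Q + peval x Q * der P.
  rewrite /der rmorphM derivM hornerD !hornerM /peval; ring.
have derC c : der c%:P = 0 by rewrite /der map_polyC derivC horner0.
have der0 Q : peval x Q = 0 -> der Q = 0.
  have [A [B [sB {3}-> eB]]] := peval_mod x Q; rewrite -eB => B0.
  have evM : peval x ('X^p - x%:P) = 0.
    by rewrite pevalB pevalC /peval map_polyXn hornerXn subrr.
  have derX : der ('X^p - x%:P) = 0.
    rewrite /der rmorphB /= map_polyXn map_polyC derivB derivC derivXn subr0.
    by rewrite hornerMn -mulr_natr (pcharf0 charK) mulr0.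
  by rewrite (frx B) // addr0 derM evM derX mulr0 mul0r addr0.
have ex u : exists Q, peval x Q == u.
  by have [Q _ ->] := spx u; exists Q.
pose Q u := xchoose (ex u).
have QE u : peval x (Q u) = u by apply/eqP/(xchooseP (ex u)).
have derE P u : peval x P = u -> der (Q u) = der P.
  move=> e; apply/eqP; rewrite -subr_eq0 -[X in _ - X]mul1r.
  have <- : der (Q u + (-1)%:P * P) = 0.
    apply: der0; rewrite pevalD pevalM pevalC QE e.
    by rewrite -(pFrobenius_autE charK) rmorphN1 mulN1r subrr.
  rewrite derD derM derC mulr0 addr0 pevalC.
  by rewrite -(pFrobenius_autE charK) rmorphN1 mulN1r mul1r.
exists (fun u => der (Q u)); split.
- by rewrite (derE 'X) ?pevalX // /der map_polyX derivX hornerC.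
- by move=> a b; rewrite (derE (Q a + Q b)) // pevalD !QE.
- by move=> a b; rewrite (derE (Q a * Q b)) ?derM ?pevalM !QE.
- by move=> a; rewrite (derE a%:P) ?derC ?pevalC.
Qed.

End PBasis.

(** * Valuations of the function field *)

Section Constants.

Variables (F : fieldType) (K : fieldExtType {fraction {poly F}}).

HB.instance Definition _ := GRing.RMorphism.copy (@constK F K)
  (in_alg K \o @FracField.tofrac {poly F} \o polyC).

Lemma constK_eq0 c : (constK K c == 0) = (c == 0).
Proof. exact: fmorph_eq0. Qed.

End Constants.

Section Places.

Variables (F : fieldType) (K : fieldExtType {fraction {poly F}}).
Variables (v : K -> int) (vP : is_place v).

(** v u >= n, with the convention v 0 = +oo. *)
Definition vge (n : int) (u : K) := (u == 0) || (n <= v u).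

Let vM a b : a != 0 -> b != 0 -> v (a * b) = v a + v b.
Proof. by case: vP => h _ _ _; exact: h. Qed.

Lemma vge0 n : vge n 0. Proof. by rewrite /vge eqxx. Qed.

Lemma vgeE n u : u != 0 -> vge n u = (n <= v u).
Proof. by rewrite /vge => /negPf ->. Qed.

Lemma vgeW m n u : n <= m -> vge m u -> vge n u.
Proof.
by move=> nm /orP[/eqP->|h]; rewrite ?vge0 // /vge (le_trans nm) ?orbT.
Qed.

Lemma vgeD n a b : vge n a -> vge n b -> vge n (a + b).
Proof.
have [->|a0] := eqVneq a 0; first by rewrite add0r.
have [->|b0] := eqVneq b 0; first by rewrite addr0.
have [->|ab0] := eqVneq (a + b) 0; first by rewrite vge0.
rewrite !vgeE // => ha hb; case: vP => _ h _ _.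
by apply: le_trans (h _ _ a0 b0 ab0); rewrite le_min ha hb.
Qed.

Lemma vgeM m n a b : vge m a -> vge n b -> vge (m + n) (a * b).
Proof.
have [->|a0] := eqVneq a 0; first by rewrite mul0r !vge0.
have [->|b0] := eqVneq b 0; first by rewrite mulr0 !vge0.
by rewrite !vgeE ?mulf_neq0 // vM // => ha hb; exact: lerD.
Qed.

Lemma vgeM0 a b : vge 0 a -> vge 0 b -> vge 0 (a * b).
Proof. exact: (@vgeM 0 0). Qed.

Lemma val_const c : c != 0 -> v (constK K c) = 0.
Proof. by case: vP => _ _ h _; exact: h. Qed.

Lemma vge_const c : vge 0 (constK K c).
Proof.
have [->|c0] := eqVneq c 0; first by rewrite rmorph0 vge0.
by rewrite vgeE ?constK_eq0 // val_const.
Qed.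

Lemma val1 : v 1 = 0.
Proof. by rewrite -(rmorph1 (@constK F K)) val_const ?oner_eq0. Qed.

Lemma valV a : a != 0 -> v a^-1 = - v a.
Proof.
move=> a0; apply/eqP; rewrite -addr_eq0 addrC -vM ?invr_eq0 //.
by rewrite divff // val1.
Qed.

Lemma valX a n : a != 0 -> v (a ^+ n) = v a * n%:Z.
Proof.
move=> a0; elim: n => [|n IH]; first by rewrite val1 mulr0.
by rewrite exprS vM ?expf_neq0 // IH -[in RHS]add1n PoszD mulrDr mulr1.
Qed.

Lemma vgeX n a : vge 0 a -> vge 0 (a ^+ n).
Proof.
move=> ha; elim: n => [|n IH]; first by rewrite vgeE ?oner_eq0 // val1.
by rewrite exprS vgeM0.
Qed.

Lemma vgeN n a : vge n a -> vge n (- a).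
Proof.
move=> ha; rewrite -mulN1r -[n]add0r vgeM //.
by rewrite -(rmorphN1 (@constK F K)) vge_const.
Qed.

Lemma vgeMn n a k : vge n a -> vge n (a *+ k).
Proof.
by move=> ha; elim: k => [|k IH]; rewrite ?vge0 // mulrS vgeD.
Qed.

Lemma vge_sum n (I : Type) (r : seq I) (P : pred I) (E : I -> K) :
  (forall i, P i -> vge n (E i)) -> vge n (\sum_(i <- r | P i) E i).
Proof. by move=> h; elim/big_ind: _ => //; [exact: vge0|exact: vgeD]. Qed.

Lemma vge0_sqrt a : vge 0 (a ^+ 2) -> vge 0 a.
Proof.
have [->|a0] := eqVneq a 0; first by rewrite vge0.
by rewrite !vgeE ?expf_neq0 // valX //; lia.
Qed.

Lemma vge0V a : ~~ vge 0 a -> vge 0 a^-1.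
Proof.
rewrite /vge negb_or => /andP[a0 h].
by rewrite invr_eq0 (negPf a0) valV //; lia.
Qed.

Lemma vge_horner (P : {poly K}) a : (forall i, vge 0 P`_i) -> vge 0 a ->
  vge 0 P.[a].
Proof.
move=> hP ha; rewrite horner_coef; apply: vge_sum => i _.
by rewrite vgeM0 // vgeX.
Qed.

Section PBasisAtPlace.

Variables (p : nat) (charK : p \in [pchar K]).
Variables (t : K) (t0 : t != 0) (vt : v t = 1).

(** The terms a ^+ p * t ^+ i with i < p have values that are distinct
    modulo p, hence never cancel. *)
Lemma vge_peval (Q : {poly K}) : (size Q <= p)%N ->
  vge 0 (peval charK t Q) -> forall i, vge 0 Q`_i.
Proof.
move=> sQ hQ i; have p_gt0 := prime_gt0 (pcharf_prime charK).
have [Qi0|Qi0] := eqVneq Q`_i 0; first by rewrite Qi0 vge0.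
have ip : (i < p)%N.
  rewrite ltnNge; apply: contra Qi0 => h.
  by rewrite nth_default ?(leq_trans sQ).
pose w (j : 'I_p) := v Q`_j * p%:Z + j%:Z.
have vE (j : 'I_p) : Q`_j != 0 -> v (Q`_j ^+ p * t ^+ j) = w j.
  by move=> h; rewrite vM ?expf_neq0 // !valX // vt mul1r.
have winj (j k : 'I_p) : w j = w k -> j = k.
  move=> /(congr1 (fun z => (z %% p)%Z)).
  rewrite !modzMDl !modz_small ?ltz_nat ?ltn_ord //=.
  by case=> e; apply: val_inj.
rewrite vgeE // leNgt; apply/negP => vneg.
pose i' := Ordinal ip.
case: (@arg_minP _ _ _ i' (fun j : 'I_p => Q`_j != 0) w Qi0) => j Qj0 minj.
have wj : w j < 0.
  apply: le_lt_trans (minj i' Qi0) _; rewrite /w /i' /=.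
  by move: (v _) vneg => z zneg; clear -zneg ip; nia.
have : vge (w j + 1) (Q`_j ^+ p * t ^+ j).
  have -> : Q`_j ^+ p * t ^+ j = peval charK t Q
     + - \sum_(k < p | k != j) Q`_k ^+ p * t ^+ k.
    by rewrite (pevalE _ _ sQ) (bigD1 j) //= addrK.
  apply: vgeD; first by apply: vgeW hQ; lia.
  apply: vgeN; apply: vge_sum => k kj.
  have [->|Qk0] := eqVneq Q`_k 0.
    by rewrite expr0n gtn_eqF // mul0r vge0.
  rewrite vgeE ?mulf_neq0 ?expf_neq0 // vE //.
  have := minj k Qk0; rewrite le_eqVlt => /orP[/eqP/winj e|]; last by lia.
  by rewrite e eqxx in kj.
by rewrite vgeE ?mulf_neq0 ?expf_neq0 // vE //; lia.
Qed.

Lemma uniformizer_p_free : p_free charK t.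
Proof.
move=> Q sQ Q0; apply/polyP => i; rewrite coef0; apply/eqP/negPn/negP => Qi0.
pose k := `|v Q`_i|%N.+1.
have : vge 0 ((t ^- k *: Q)`_i).
  apply: vge_peval; first by rewrite (leq_trans (size_scale_leq _ _)).
  by rewrite pevalZ Q0 mulr0 vge0.
rewrite coefZ vgeE ?mulf_neq0 ?invr_eq0 ?expf_neq0 //.
rewrite vM ?invr_eq0 ?expf_neq0 // valV ?expf_neq0 // valX // vt /k.
by move: (v _) => z; lia.
Qed.

End PBasisAtPlace.

End Places.

(** * Differentials at a place *)

Section Differentials.

Variables (F : fieldType) (K : fieldExtType {fraction {poly F}}).

Definition evalK (X : K) (q : {poly F}) : K := (map_poly (constK K) q).[X].

Section Eval.
Variable X : K.
Lemma evalKD a b : evalK X (a + b) = evalK X a + evalK X b.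
Proof. by rewrite /evalK rmorphD hornerD. Qed.
Lemma evalKN a : evalK X (- a) = - evalK X a.
Proof. by rewrite /evalK rmorphN hornerN. Qed.
Lemma evalKM a b : evalK X (a * b) = evalK X a * evalK X b.
Proof. by rewrite /evalK rmorphM hornerM. Qed.
Lemma evalKXn a n : evalK X (a ^+ n) = evalK X a ^+ n.
Proof. by rewrite /evalK rmorphXn horner_exp. Qed.
Lemma evalKC c : evalK X c%:P = constK K c.
Proof. by rewrite /evalK map_polyC hornerC. Qed.
Lemma evalKX : evalK X 'X = X.
Proof. by rewrite /evalK map_polyX hornerX. Qed.
Lemma evalK0 : evalK X 0 = 0.
Proof. by rewrite /evalK map_poly0 horner0. Qed.
Lemma evalK1 : evalK X 1 = 1.
Proof. by rewrite /evalK rmorph1 hornerC. Qed.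
Lemma evalK_sum n (q : {poly F}) : (size q <= n)%N ->
  evalK X q = \sum_(i < n) constK K q`_i * X ^+ i.
Proof.
move=> sq; rewrite /evalK (horner_coef_wide _ (n := n)) ?size_map_poly //.
by apply: eq_bigr => i _; rewrite coef_map.
Qed.
Lemma vge_evalK v q : is_place v -> vge v 0 X -> vge v 0 (evalK X q).
Proof.
by move=> vP; apply: vge_horner => // i; rewrite coef_map vge_const.
Qed.
End Eval.

Variables (Omega : lmodType K) (d : K -> Omega) (dP : is_derivation d).

Lemma dD a b : d (a + b) = d a + d b.
Proof. by case: dP => h _ _; exact: h. Qed.

Lemma dM a b : d (a * b) = a *: d b + b *: d a.
Proof. by case: dP => _ h _; exact: h. Qed.

Lemma d_const c : d (constK K c) = 0.
Proof. by case: dP => _ _ h; exact: h. Qed.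

Lemma d0 : d 0 = 0.
Proof. by rewrite -(d_const 0) rmorph0. Qed.

Lemma dXn a n : d (a ^+ n) = (a ^+ n.-1 *+ n) *: d a.
Proof.
elim: n => [|n IH]; first by rewrite scale0r -(d_const 1) rmorph1.
rewrite exprS dM IH scalerA -scalerDl; congr (_ *: _).
case: n {IH} => [|n]; rewrite ?mulr0 ?add0r //=.
by rewrite mulrnAr -exprS [RHS]mulrS addrC.
Qed.

Lemma d_horner (P : {poly K}) t : (forall i, d P`_i = 0) ->
  d P.[t] = P^`().[t] *: d t.
Proof.
elim/poly_ind: P => [|P c IH] h; first by rewrite derivC !horner0 d0 scale0r.
have dc : d c = 0 by have := h 0%N; rewrite coefD coefMX coefC add0r.
have dP' i : d P`_i = 0 by have := h i.+1; rewrite coefD coefMX coefC addr0.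
rewrite hornerMXaddC dD dM dc addr0 IH // scalerA -scalerDl.
by rewrite derivD derivC addr0 derivM derivX mulr1 hornerD hornerMX mulrC addrC.
Qed.

Lemma d_evalK X q : d (evalK X q) = evalK X q^`() *: d X.
Proof.
rewrite /evalK d_horner ?deriv_map // => i.
by rewrite coef_map d_const.
Qed.

Variables (p : nat) (charK : p \in [pchar K]).

Lemma d_pth_power a : d (a ^+ p) = 0.
Proof. by rewrite dXn -mulr_natr (pcharf0 charK) mulr0 scale0r. Qed.

Lemma d_peval t Q :
  d (peval charK t Q) = (map_poly (pFrobenius_aut charK) Q)^`().[t] *: d t.
Proof. by apply: d_horner => i; rewrite coef_map d_pth_power. Qed.

Variables (x : K) (spx : p_spans charK x).

Section AtPlace.

Variables (v : K -> int) (vP : is_place v).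
Variables (t : K) (t0 : t != 0) (vt : v t = 1).

(** Expand u on the p-basis formed by the uniformizer t, with coefficients
    that are p-th powers of integral elements, and differentiate termwise. *)
Lemma d_integral u : vge v 0 u -> exists2 g, vge v 0 g & d u = g *: d t.
Proof.
have [Q sQ ->] := p_basis_exchange spx (uniformizer_p_free vP t0 vt) u.
move=> /(vge_peval vP t0 vt sQ) Qi; rewrite d_peval.
eexists; last by [].
have vt0 : vge v 0 t by rewrite vgeE // vt.
apply: vge_horner => // i.
by rewrite coef_deriv vgeMn // coef_map vgeX.
Qed.

Lemma regular_at_uniformizer w : regular_at d v w ->
  exists2 g, vge v 0 g & w = g *: d t.
Proof.
case=> t' [g [t'0 vt' hg ->]].
have [|g' hg' ->] := @d_integral t'; first by rewrite vgeE // vt'.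
exists (g * g'); last by rewrite scalerA.
by apply: vgeM0 => //; case: hg => [->|h]; rewrite /vge ?eqxx ?h ?orbT.
Qed.

Lemma d_uniformizer_neq0 : d x != 0 -> d t != 0.
Proof.
have [Q sQ xE] := p_basis_exchange spx (uniformizer_p_free vP t0 vt) x.
by rewrite [in d x]xE d_peval scaler_eq0 negb_or => /andP[].
Qed.

End AtPlace.

End Differentials.

(** The universal property maps d x to the value 1 of the derivation with
    respect to the p-basis. *)
Lemma kahler_d_neq0 (F : fieldType) (K : fieldExtType {fraction {poly F}})
    (Omega : lmodType K) (d : K -> Omega) (p : nat) (charK : p \in [pchar K])
    (x : K) :
  (forall c : F, exists b, b ^+ p = c) -> is_kahler d ->
  p_spans charK x -> p_free charK x -> d x != 0.
Proof.
move=> root [_ univ] spx frx.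
have [D [Dx DD DM Dp]] := p_basis_derivation spx frx.
have [|h [hd _]] := univ K^o D.
  split=> // c; have [b <-] := root c.
  by rewrite rmorphXn Dp.
apply/eqP => dx0; have := hd x; rewrite dx0 Dx linear0 => /eqP.
by rewrite eq_sym oner_eq0.
Qed.

(** * Places from residues *)

Section PlaceOfResidue.

Variables (F : fieldType) (K : fieldExtType {fraction {poly F}}).
Variables (res : K -> F -> Prop) (t : K).

Definition has_order (u : K) (n : int) :=
  exists2 r, r != 0 & res (u * t ^ (- n)) r.

Hypotheses (res_const : forall c, res (constK K c) c).
Hypotheses (resD : forall u v r s, res u r -> res v s -> res (u + v) (r + s)).
Hypotheses (resM : forall u v r s, res u r -> res v s -> res (u * v) (r * s)).
Hypotheses (res0 : forall r, res 0 r -> r = 0).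
Hypotheses (t0 : t != 0) (rest : res t 0).

Let t_unit : t \is a GRing.unit. Proof. by rewrite unitfE. Qed.

Lemma res_unique u r s : res u r -> res u s -> r = s.
Proof.
move=> hr hs; apply/eqP; rewrite -subr_eq0; apply/eqP/res0.
rewrite -(subrr u) -[- u]mulN1r -[- s]mulN1r; apply: resD => //.
by apply: resM => //; rewrite -(rmorphN1 (@constK F K)); exact: res_const.
Qed.

Lemma res_mul_pos u r n : 0 < n -> res u r -> res (u * t ^ n) 0.
Proof.
case: n => // -[//|n] _ h; rewrite -[0 in X in res _ X](mulr0 r).
apply: resM => //.
elim: n => [|n IH]; first by rewrite expr1z.
by rewrite exprSz -[0 in X in res _ X](mulr0 0); apply: resM.
Qed.

Lemma has_order_ge0 u n r : has_order u n -> res u r -> 0 <= n.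
Proof.
case=> s s0 hs hr; rewrite leNgt; apply/negP => n0.
have h : res (u * t ^ (- n)) 0 by apply: res_mul_pos hr; lia.
by rewrite (res_unique hs h) eqxx in s0.
Qed.

Lemma has_order_gt0 u n r : has_order u n -> res u r -> 0 < n -> r = 0.
Proof.
case=> s s0 hs hr n0; apply: res_unique hr _.
have := res_mul_pos n0 hs.
by rewrite -mulrA -expfzDr // addNr expr0z mulr1.
Qed.

Lemma has_order_shift u n k : has_order u n ->
  has_order (u * t ^ (- k)) (n - k).
Proof.
case=> r r0 h; exists r => //.
by rewrite -mulrA -expfzDr //; have -> : - k + - (n - k) = - n by lia.
Qed.

Lemma has_orderM u v m n :
  has_order u m -> has_order v n -> has_order (u * v) (m + n).
Proof.
case=> r r0 hr [s s0 hs]; exists (r * s); first by rewrite mulf_neq0.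
have := resM hr hs; rewrite mulrACA -expfzDr //.
by have -> : - m + - n = - (m + n) by lia.
Qed.

Lemma has_order_unique u m n : has_order u m -> has_order u n -> m = n.
Proof.
wlog mn : m n / m <= n.
  by move=> W hm hn; have [/W->|/ltW/W->] := leP m n.
move=> hm hn; apply/eqP; rewrite eq_le mn /=.
have [r r0 hr] := hn.
have := has_order_ge0 (has_order_shift n hm) hr; lia.
Qed.

Lemma has_order_const c : c != 0 -> has_order (constK K c) 0.
Proof. by move=> c0; exists c => //; rewrite oppr0 expr0z mulr1. Qed.

Lemma has_order_uniformizer : has_order t 1.
Proof.
exists 1; rewrite ?oner_eq0 // -[X in X * _]expr1z -expfzDr // subrr expr0z.
by rewrite -(rmorph1 (@constK F K)); exact: res_const.
Qed.

Hypothesis order_ex : forall u, u != 0 -> exists n, has_order u n.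

(** The elements that have a residue form a valuation ring whose maximal ideal
    is generated by t. Orders are unique because multiplication by a positive
    power of t turns every residue into 0, and the ultrametric inequality holds
    because an element that has a residue is of order at least 0. *)
Lemma place_of_residue : exists v, [/\ is_place v,
  forall u n, u != 0 -> has_order u n -> v u = n
  & forall u r, res u r -> vge v 0 u /\ (vge v 1 u -> r = 0)].
Proof.
have [|v vE] := @functional_choice K int (fun u n => u != 0 -> has_order u n).
  by move=> u; have [->|/order_ex[n h]] := eqVneq u 0; [exists 0|exists n].
have vP u n : u != 0 -> has_order u n -> v u = n.
  by move=> u0; apply: has_order_unique (vE u u0).
have vD a b : a != 0 -> b != 0 -> a + b != 0 -> v a <= v b -> v a <= v (a + b).
  move=> a0 b0 ab0 ab; have [r _ hr] := vE a a0.
  have [s hs] : exists s, res (b * t ^ (- v a)) s.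
    have [s s0 hs] := vE b b0; move: ab; rewrite le_eqVlt => /orP[/eqP->|ab].
      by exists s.
    exists 0; have := @res_mul_pos _ _ (v b - v a) _ hs.
    by rewrite -mulrA -expfzDr // addrA addNr add0r; apply; lia.
  have := resD hr hs; rewrite -mulrDl.
  move/(has_order_ge0 (has_order_shift (v a) (vE _ ab0))); lia.
exists v; split=> //.
- split.
  + move=> a b a0 b0; apply: vP; rewrite ?mulf_neq0 //.
    by apply: has_orderM; apply: vE.
  + move=> a b a0 b0 ab0; have [ab|/ltW ab] := leP (v a) (v b).
      exact: vD.
    by rewrite addrC; apply: vD; rewrite // addrC.
  + by move=> c c0; apply: vP (has_order_const c0); rewrite constK_eq0.
  + by exists t => //; apply: vP has_order_uniformizer.
- move=> u r hr; have [u0|u0] := eqVneq u 0.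
    split=> [|_]; first by rewrite u0 vge0.
    by apply: res0; rewrite -u0.
  rewrite !vgeE //; split; first exact: has_order_ge0 (vE u u0) hr.
  by move=> h; apply: has_order_gt0 (vE u u0) hr _; lia.
Qed.

End PlaceOfResidue.

(** * Places of a double cover of the line *)

Definition evalK2 (F : fieldType) (K : fieldExtType {fraction {poly F}})
    (X Y : K) (P Q : {poly F}) : K := evalK X P + evalK X Q * Y.

(** The field is F(X, Y) with Y ^+ 2 = f(X) and Y outside F(X). Keeping X and Y
    arbitrary lets (x, y) and the chart (1 / x, y / x ^ n) at infinity be
    treated by the same lemmas. *)
Definition double_cover (F : fieldType) (K : fieldExtType {fraction {poly F}})
    (f : {poly F}) (X Y : K) : Prop :=
  [/\ Y ^+ 2 = evalK X f,
      forall P Q, evalK2 X Y P Q = 0 -> P = 0 /\ Q = 0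
    & forall u, exists P Q R : {poly F},
        R != 0 /\ u * evalK X R = evalK2 X Y P Q].

Section PlacesOfDoubleCover.

Variables (F : fieldType) (K : fieldExtType {fraction {poly F}}).
Variables (f : {poly F}) (X Y : K) (cover : double_cover f X Y).

Local Notation bi := (evalK2 X Y).

Lemma evalK2_0 P : bi P 0 = evalK X P.
Proof. by rewrite /evalK2 evalK0 mul0r addr0. Qed.

Lemma evalK2D P Q P' Q' : bi P Q + bi P' Q' = bi (P + P') (Q + Q').
Proof. rewrite /evalK2 !evalKD; ring. Qed.

Lemma evalK2M P Q P' Q' :
  bi P Q * bi P' Q' = bi (P * P' + Q * Q' * f) (P * Q' + Q * P').
Proof.
have [Y2 _ _] := cover.
rewrite /evalK2 !evalKD !evalKM -Y2; ring.
Qed.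

Lemma evalK_eq0 P : evalK X P = 0 -> P = 0.
Proof. by have [_ h _] := cover; rewrite -evalK2_0 => /h[]. Qed.

Lemma evalK_neq0 P : P != 0 -> evalK X P != 0.
Proof. by apply: contra => /eqP/evalK_eq0->. Qed.

Variables (c y0 : F) (y0P : y0 ^+ 2 = f.[c]).

Definition value (P Q : {poly F}) : F := P.[c] + Q.[c] * y0.

Lemma valueD P Q P' Q' : value P Q + value P' Q' = value (P + P') (Q + Q').
Proof. by rewrite /value !hornerD mulrDl addrACA. Qed.

Lemma valueM P Q P' Q' :
  value P Q * value P' Q' = value (P * P' + Q * Q' * f) (P * Q' + Q * P').
Proof. by rewrite /value !hornerE -y0P; ring. Qed.

(** Being finite with residue r at (c, y0) is a relation because a function
    can be written as a quotient in many ways, some of which are undetermined at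
    the point. *)
Definition residue (u : K) (r : F) : Prop :=
  exists P Q R S, [/\ value R S != 0, u * bi R S = bi P Q
    & r * value R S = value P Q].

Lemma value0 P : value P 0 = P.[c].
Proof. by rewrite /value horner0 mul0r addr0. Qed.

Lemma residue_evalK2 P Q : residue (bi P Q) (value P Q).
Proof.
exists P, Q, 1, 0; rewrite evalK2_0 evalK1 value0 hornerC !mulr1.
by rewrite oner_eq0.
Qed.

Lemma residue_eval P : residue (evalK X P) P.[c].
Proof. by rewrite -evalK2_0 -value0; apply: residue_evalK2. Qed.

Lemma residue_const a : residue (constK K a) a.
Proof. by have := residue_eval a%:P; rewrite evalKC hornerC. Qed.

Lemma residueD u u' r r' : residue u r -> residue u' r' ->
  residue (u + u') (r + r').
Proof.
move=> [P [Q [R [S [h e k]]]]] [P' [Q' [R' [S' [h' e' k']]]]].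
exists (P * R' + Q * S' * f + (P' * R + Q' * S * f)),
  (P * S' + Q * R' + (P' * S + Q' * R)),
  (R * R' + S * S' * f), (R * S' + S * R').
split.
- by rewrite -valueM mulf_neq0.
- transitivity (bi P Q * bi R' S' + bi P' Q' * bi R S).
    by rewrite -e -e' -evalK2M; ring.
  by rewrite !evalK2M evalK2D.
- rewrite -valueM.
  transitivity (value P Q * value R' S' + value P' Q' * value R S).
    by rewrite -k -k' mulrDl [in X in _ + X](mulrC (value R S)) !mulrA.
  by rewrite !valueM valueD.
Qed.

Lemma residueM u u' r r' : residue u r -> residue u' r' ->
  residue (u * u') (r * r').
Proof.
move=> [P [Q [R [S [h e k]]]]] [P' [Q' [R' [S' [h' e' k']]]]].
exists (P * P' + Q * Q' * f), (P * Q' + Q * P').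
exists (R * R' + S * S' * f), (R * S' + S * R').
rewrite -!valueM -!evalK2M; split.
- by rewrite mulf_neq0.
- by rewrite mulrACA e e'.
- by rewrite mulrACA k k'.
Qed.

Lemma residue0 r : residue 0 r -> r = 0.
Proof.
move=> [P [Q [R [S [h]]]]]; rewrite mul0r => e; have [_ ind _] := cover.
have [-> ->] := ind P Q (esym e).
by rewrite value0 horner0 => /eqP; rewrite mulf_eq0 (negPf h) orbF => /eqP.
Qed.

Lemma residueV u r : r != 0 -> residue u r -> residue u^-1 r^-1.
Proof.
move=> r0 [P [Q [R [S [h e k]]]]].
have u0 : u != 0.
  apply: contraNneq r0 => u0; apply/eqP/residue0.
  by rewrite -u0; exists P, Q, R, S.
exists R, S, P, Q; rewrite -k -e; split.
- by rewrite mulf_neq0.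
- by rewrite mulKf.
- by rewrite mulKf.
Qed.

Section Uniformizer.

Variables (t : K) (t0 : t != 0) (rest : residue t 0).

Local Notation ord := (has_order residue t).

Lemma ordM u v m n : ord u m -> ord v n -> ord (u * v) (m + n).
Proof. by apply: has_orderM => //; exact: residueM. Qed.

Lemma ordV u n : ord u n -> ord u^-1 (- n).
Proof.
case=> r r0 h; exists r^-1; first by rewrite invr_eq0.
by have := residueV r0 h; rewrite invfM invr_expz.
Qed.

Lemma ord_unit u r : r != 0 -> residue u r -> ord u 0.
Proof. by move=> r0 h; exists r => //; rewrite oppr0 expr0z mulr1. Qed.

(** Common factors X - c of P and Q can be taken out, and a P + Q Y that does
    not vanish at the point has order 0. *)
Lemma ord_ex :
  (exists n, ord (evalK X ('X - c%:P)) n) ->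
  (forall P Q, value P Q = 0 -> (P.[c] != 0) || (Q.[c] != 0) ->
    exists n, ord (bi P Q) n) ->
  forall u, u != 0 -> exists n, ord u n.
Proof.
move=> [e he] hbi.
have ordbi n (P Q : {poly F}) :
    (size P + size Q <= n)%N -> (P != 0) || (Q != 0) ->
    exists n, ord (bi P Q) n.
  elim: n P Q => [|n IH] P Q.
    by rewrite leqn0 addn_eq0 !size_poly_eq0 => /andP[-> ->].
  move=> sPQ PQ0.
  have [nz|] := boolP ((P.[c] != 0) || (Q.[c] != 0)).
    have [v0|v0] := eqVneq (value P Q) 0; first exact: hbi.
    by exists 0; apply: ord_unit v0 (residue_evalK2 _ _).
  rewrite negb_or !negbK => /andP[rP rQ].
  have /factor_theorem [P1 PE] : root P c by [].
  have /factor_theorem [Q1 QE] : root Q c by [].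
  have szXc (A : {poly F}) : A != 0 -> size (A * ('X - c%:P)) = (size A).+1.
    by move=> A0; rewrite size_Mmonic ?monicXsubC // size_XsubC addn2.
  have [||k hk] := IH P1 Q1.
  - move: sPQ PQ0; rewrite PE QE.
    have [->|P10] := eqVneq P1 0; have [->|Q10] := eqVneq Q1 0;
      rewrite ?mul0r ?eqxx // ?szXc // ?size_poly0; lia.
  - by move: PQ0; rewrite PE QE !mulf_eq0 polyXsubC_eq0 !orbF.
  exists (k + e); have := ordM hk he.
  by rewrite PE QE /evalK2 !evalKM mulrDl mulrAC.
move=> u u0; have [_ _ gen] := cover; have [P [Q [R [R0 uE]]]] := gen u.
have [m hm] := ordbi _ R 0 (leqnn _) (introT orP (or_introl R0)).
have [|k hk] := ordbi _ P Q (leqnn _).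
  rewrite -negb_and; apply: contraNN u0 => /andP[/eqP P0 /eqP Q0].
  move: uE; rewrite P0 Q0 evalK2_0 evalK0 => /eqP.
  by rewrite mulf_eq0 (negPf (evalK_neq0 R0)) orbF.
exists (k - m); have := ordM hk (ordV hm).
by rewrite -uE evalK2_0 mulfK ?evalK_neq0.
Qed.

End Uniformizer.

Hypothesis two_neq0 : 2%:R != 0 :> F.

Lemma Y_neq0 : Y != 0.
Proof.
have [_ ind _] := cover; apply/eqP => Y0.
have [|_ /eqP] := ind 0 1.
  by rewrite /evalK2 evalK0 evalK1 Y0 mulr0 addr0.
by rewrite oner_eq0.
Qed.

Lemma residue_Y : residue Y y0.
Proof.
have := residue_evalK2 0 1.
by rewrite /evalK2 /value evalK0 evalK1 horner0 hornerC !mul1r !add0r.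
Qed.

Lemma residue_XsubC : residue (evalK X ('X - c%:P)) 0.
Proof. by have := residue_eval ('X - c%:P); rewrite hornerXsubC subrr. Qed.

(** If P + Q Y vanishes at (c, y0), then P - Q Y does not, and their product
    P ^+ 2 - Q ^+ 2 f is a polynomial in X, whose order is the multiplicity of
    its zero c. *)
Lemma ord_ex_unramified u : f.[c] != 0 -> u != 0 ->
  exists n, has_order residue (evalK X ('X - c%:P)) u n.
Proof.
move=> fc u0; set t := evalK X _.
have t0 : t != 0 by rewrite evalK_neq0 // polyXsubC_eq0.
have y00 : y0 != 0 by move: fc; rewrite -y0P expf_eq0.
have ordt : has_order residue t t 1.
  by apply: has_order_uniformizer => //; exact: residue_const.
apply: (ord_ex t0) => //; first by exists 1.
have ordP P : P != 0 -> exists n, has_order residue t (evalK X P) n.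
  move=> P0; have [m [Q rQ ->]] := multiplicity_XsubC P c.
  rewrite P0 /= in rQ.
  exists (0 + m%:Z); rewrite evalKM evalKXn; apply: ordM => //.
    by apply: (ord_unit t) (residue_eval Q); rewrite -rootE.
  elim: m => [|m IH].
    rewrite expr0; apply: (ord_unit t) (oner_neq0 F) _.
    by rewrite -(rmorph1 (@constK F K)); exact: residue_const.
  by rewrite exprS intS; apply: ordM.
move=> P Q PQ0 nz.
have NE : bi P Q * bi P (- Q) = evalK X (P ^+ 2 - Q ^+ 2 * f).
  by rewrite evalK2M -evalK2_0; congr bi; ring.
have vN : value P (- Q) != 0.
  apply: contraTneq nz => PmQ0.
  have Pc : P.[c] == 0.
    have : value P Q + value P (- Q) = 0 by rewrite PQ0 PmQ0 addr0.
    rewrite valueD subrr value0 hornerD -mulr2n -mulr_natl => /eqP.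
    by rewrite mulf_eq0 (negPf two_neq0).
  move: PQ0; rewrite /value (eqP Pc) add0r => /eqP.
  by rewrite mulf_eq0 (negPf y00) orbF => ->; rewrite eqxx.
have [_ ind _] := cover.
have bi0 A B : (A != 0) || (B != 0) -> bi A B != 0.
  by apply: contraTneq => /ind[-> ->]; rewrite eqxx.
have PQn0 : (P != 0) || (Q != 0).
  apply: contraTT nz; rewrite negb_or !negbK => /andP[/eqP-> /eqP->].
  by rewrite horner0 eqxx.
have n0 : P ^+ 2 - Q ^+ 2 * f != 0.
  apply: contraTneq (bi0 _ _ PQn0) => N0; rewrite negbK.
  move/eqP: NE; rewrite N0 evalK0 mulf_eq0 => /orP[//|]; apply: contraLR => _.
  by apply: bi0; rewrite oppr_eq0.
have [n hn] := ordP _ n0.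
exists (n - 0).
have -> : bi P Q = evalK X (P ^+ 2 - Q ^+ 2 * f) * (bi P (- Q))^-1.
  by rewrite -NE mulfK // bi0 // oppr_eq0.
apply: ordM => //; apply: ordV => //.
exact: ord_unit vN (residue_evalK2 _ _).
Qed.

(** With f = (X - c) f1, the equation reads X - c = Y ^+ 2 / f1(X), so that Y
    can be factored out of P + Q Y as soon as P(c) = 0. *)
Lemma ord_ex_ramified u : f.[c] = 0 -> f^`().[c] != 0 -> u != 0 ->
  exists n, has_order residue Y u n.
Proof.
move=> fc f'c u0.
have y00 : y0 = 0 by apply/eqP; move: y0P; rewrite fc => /eqP; rewrite expf_eq0.
have [f1 fE] : exists f1, f = f1 * ('X - c%:P) by apply/factor_theorem/eqP.
have f1c : f1.[c] != 0.
  by move: f'c; rewrite fE derivM derivXsubC hornerD !hornerM hornerXsubC subrr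
     mulr0 add0r hornerC mulr1.
have restY : residue Y 0 by rewrite -y00; exact: residue_Y.
have f1n0 : f1 != 0 by apply: contraNneq f1c => ->; rewrite horner0.
have ordY : has_order residue Y Y 1.
  by apply: has_order_uniformizer; [exact: residue_const|exact: Y_neq0].
have ordf1 : has_order residue Y (evalK X f1)^-1 0.
  by rewrite -oppr0; apply: ordV; apply: ord_unit f1c (residue_eval _).
have XE : evalK X ('X - c%:P) = Y * Y * (evalK X f1)^-1.
  have [Y2 _ _] := cover.
  by rewrite -expr2 Y2 fE evalKM (mulrC (evalK X f1)) mulfK // evalK_neq0.
have ordX : has_order residue Y (evalK X ('X - c%:P)) (1 + 1 + 0).
  by rewrite XE; apply: ordM Y_neq0 _ _ _ _ _ ordf1;
    apply: ordM Y_neq0 _ _ _ _ _ _.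
apply: ord_ex u0; rewrite ?Y_neq0 //; first by eexists; exact: ordX.
move=> P Q; rewrite /value y00 mulr0 addr0 => Pc; rewrite Pc eqxx /= => Qc.
have [P1 PE] : exists P1, P = P1 * ('X - c%:P) by apply/factor_theorem/eqP.
exists (1 + (0 + 0)).
have -> : bi P Q = Y * (bi (Q * f1) P1 * (evalK X f1)^-1).
  rewrite PE /evalK2 !evalKM XE.
  by field; rewrite evalK_neq0.
apply: ordM => //; first exact: Y_neq0.
apply: ordM => //; first exact: Y_neq0.
apply: ord_unit (residue_evalK2 _ _).
by rewrite /value y00 mulr0 addr0 hornerM mulf_neq0.
Qed.

(** The last clause is what ties v to the point (c, y0) rather than to
    (c, - y0). *)
Lemma place_at_point : (f.[c] != 0) || (f^`().[c] != 0) ->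
  exists v, [/\ is_place v,
    f.[c] != 0 -> v (evalK X ('X - c%:P)) = 1,
    f.[c] = 0 -> v Y = 1
  & forall P Q, vge v 0 (bi P Q) /\ (vge v 1 (bi P Q) -> value P Q = 0)].
Proof.
have [fc f'c|fc _] := eqVneq f.[c] 0.
  have y00 : y0 = 0.
    by apply/eqP; move: y0P; rewrite fc => /eqP; rewrite expf_eq0.
  have [|||||||v [vP vE vr]] := @place_of_residue F K residue Y.
  - exact: residue_const.
  - exact: residueD.
  - exact: residueM.
  - exact: residue0.
  - exact: Y_neq0.
  - by rewrite -y00; exact: residue_Y.
  - by move=> u; apply: ord_ex_ramified.
  exists v; split=> // [_|P Q]; last exact: vr (residue_evalK2 _ _).
  by apply: vE (Y_neq0) _; apply: has_order_uniformizer;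
    [exact: residue_const|exact: Y_neq0].
have t0 : evalK X ('X - c%:P) != 0 by rewrite evalK_neq0 // polyXsubC_eq0.
have [|||||||v [vP vE vr]] :=
  @place_of_residue F K residue (evalK X ('X - c%:P)).
- exact: residue_const.
- exact: residueD.
- exact: residueM.
- exact: residue0.
- exact: t0.
- exact: residue_XsubC.
- by move=> u; apply: ord_ex_unramified.
exists v; split=> // [_|fc0|P Q]; last exact: vr (residue_evalK2 _ _).
  by apply: (vE _ _ t0); apply: has_order_uniformizer => //;
    exact: residue_const.
by rewrite fc0 eqxx in fc.
Qed.

End PlacesOfDoubleCover.

(** * Poles of differentials on a double cover *)

Lemma closed_root_exists (F : closedFieldType) n (a : F) :
  (0 < n)%N -> exists b, b ^+ n = a.
Proof.
move=> n0; have [|b /rootP] := closed_rootP ('X^n - a%:P) _.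
  by rewrite size_XnsubC // eqSS -lt0n.
by rewrite !hornerE => /eqP; rewrite subr_eq0 => /eqP; exists b.
Qed.

Section HolomorphicOnDoubleCover.

Variables (F : closedFieldType) (K : fieldExtType {fraction {poly F}}).
Variables (Omega : lmodType K) (d : K -> Omega) (dP : is_derivation d).
Variables (p : nat) (charK : p \in [pchar K]).
Variables (x : K) (spx : p_spans charK x) (dx_neq0 : d x != 0).
Variables (f : {poly F}) (X Y : K) (cover : double_cover f X Y).

Let Y2 : Y ^+ 2 = evalK X f. Proof. by case: cover. Qed.
Let Y0 : Y != 0. Proof. exact: Y_neq0 cover. Qed.

Lemma d_sqrt : evalK X f^`() *: d X = (Y *+ 2) *: d Y.
Proof. by rewrite -d_evalK // -Y2 dXn. Qed.

(** By a f + b f' = 1, the differential dX / Y equals a Y dX + 2 b dY, which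
    has no pole where X has none. *)
Lemma dXoverY_regular v t (a b : {poly F}) : is_place v -> t != 0 -> v t = 1 ->
  a * f + b * f^`() = 1 -> vge v 0 X ->
  exists2 g, vge v 0 g & Y^-1 *: d X = g *: d t.
Proof.
move=> vP t0 vt bezout vX.
have vY : vge v 0 Y by apply: vge0_sqrt => //; rewrite Y2 vge_evalK.
have [gX vgX dX] := d_integral dP spx vP t0 vt vX.
have [gY vgY dY] := d_integral dP spx vP t0 vt vY.
exists (evalK X a * Y * gX + (evalK X b * gY) *+ 2).
  by rewrite vgeD ?vgeMn // !vgeM0 // vge_evalK.
transitivity (Y^-1 *: (evalK X (a * f + b * f^`()) *: d X)).
  by rewrite bezout evalK1 scale1r.
have E1 : Y^-1 * evalK X (a * f) = evalK X a * Y.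
  by rewrite evalKM -Y2; field.
have E2 : Y^-1 *: (evalK X (b * f^`()) *: d X) = (evalK X b *+ 2) *: d Y.
  rewrite evalKM -[(evalK X b * _) *: _]scalerA d_sqrt.
  rewrite (scalerA (evalK X b)) (scalerA Y^-1); congr (_ *: _).
  by field.
rewrite evalKD (scalerDl (d X)) scalerDr E2 (scalerA Y^-1) E1 dX dY.
by rewrite (scalerA _ gX) (scalerA _ gY) mulrnAl -scalerDl.
Qed.

Hypothesis two_neq0 : 2%:R != 0 :> F.

Local Notation bi := (evalK2 X Y).

(** If f(c) != 0 then X - c is a uniformizer at both points above c and dX / Y
    is dX times a unit, so u is integral and P + Q Y = u R(X) vanishes at both
    points. If f(c) = 0 then dX / Y is dY times a unit, so u is integral, and
    X - c has order 2: as u R(X) has order at least 2, first P(c) = 0, then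
    P(X) has order at least 2, and what remains for Q(X) is order at least 1.
  *)
Lemma holomorphic_numerator_root w u (P Q R : {poly F}) c :
  (f.[c] != 0) || (f^`().[c] != 0) ->
  holomorphic d w -> w = (u / Y) *: d X ->
  u * evalK X R = bi P Q -> R.[c] = 0 -> P.[c] = 0 /\ Q.[c] = 0.
Proof.
move=> sm hol wE uE /eqP/factor_theorem[R1 RE].
have [y0 y0P] := @closed_root_exists F 2 f.[c] isT.
have dXsubC : d (evalK X ('X - c%:P)) = d X.
  by rewrite d_evalK // derivXsubC evalK1 scale1r.
have X0 : evalK X ('X - c%:P) != 0.
  by rewrite (evalK_neq0 cover) // polyXsubC_eq0.
have scale_inj (e : Omega) a b : e != 0 -> a *: e = b *: e -> a = b.
  move=> e0 /eqP; rewrite -subr_eq0 -scalerBl scaler_eq0 (negPf e0) orbF.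
  by rewrite subr_eq0 => /eqP.
have [fc|fc] := eqVneq f.[c] 0.
  have f'c : f^`().[c] != 0 by move: sm; rewrite fc eqxx.
  have y00 : y0 = 0.
    by apply/eqP; move: y0P; rewrite fc => /eqP; rewrite expf_eq0.
  have [v [vP _ /(_ fc) vY vr]] := place_at_point cover y0P two_neq0 sm.
  have [g vg] := regular_at_uniformizer dP spx vP Y0 vY (hol v vP).
  rewrite wE => gE.
  (* f'(X) dX = 2 Y dY turns the coefficient of dX / Y into one of dY. *)
  have uint : vge v 0 u.
    have -> : u = constK K 2%:R^-1 * (evalK X f^`() * g).
      have -> : evalK X f^`() * g = u * 2%:R.
        apply: (scale_inj (d Y)).
          exact: (d_uniformizer_neq0 dP spx vP Y0 vY).
        rewrite -[LHS]scalerA -gE scalerA mulrC -scalerA d_sqrt scalerA.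
        by congr (_ *: _); field.
      rewrite -(rmorph_nat (@constK F K)) mulrCA -rmorphM mulVf //.
      by rewrite rmorph1 mulr1.
    rewrite vgeM0 ?vge_const // vgeM0 //.
    by rewrite -(evalK2_0 X Y); case: (vr f^`() 0).
  have [f1 fE] : exists f1, f = f1 * ('X - c%:P) by apply/factor_theorem/eqP.
  have f1c : f1.[c] != 0.
    move: f'c; rewrite fE derivM derivXsubC hornerD !hornerM hornerXsubC.
    by rewrite subrr mulr0 add0r hornerC mulr1.
  have f1n0 : f1 != 0 by apply: contraNneq f1c => ->; rewrite horner0.
  have vP1 A : vge v 1 (evalK X A) -> A.[c] = 0.
    by rewrite -(evalK2_0 X Y); case: (vr A 0) => _ h /h; rewrite value0.
  have vX : v (evalK X ('X - c%:P)) = 2.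
    have vf10 : v (evalK X f1) = 0.
      have f1K := evalK_neq0 cover f1n0.
      have := vP1 f1; have := (vr f1 0).1; rewrite evalK2_0 !vgeE // => h1 h2.
      apply/eqP; rewrite eq_le h1 andbT leNgt; apply/negP => h3.
      by move/eqP: (h2 h3); rewrite (negPf f1c).
    have : v (Y ^+ 2) = 2 by rewrite valX // vY.
    rewrite Y2 fE evalKM; case: (vP) => vM _ _ _; rewrite vM ?evalK_neq0 //.
      by rewrite vf10 add0r.
    exact: (evalK_neq0 cover).
  have v2 (A : {poly F}) : A.[c] = 0 -> vge v 2 (evalK X A).
    move/eqP/factor_theorem => [A1 ->]; rewrite evalKM -[2]add0r.
    apply: vgeM => //; last by rewrite vgeE // vX.
    by rewrite -(evalK2_0 X Y); case: (vr A1 0).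
  have vPQ : vge v 2 (bi P Q).
    rewrite -uE -[2]add0r; apply: vgeM => //; apply: v2.
    by rewrite RE hornerM hornerXsubC subrr mulr0.
  have Pc : P.[c] = 0.
    have [_ h] := vr P Q; have := h (@vgeW _ _ _ 2 1 _ isT vPQ).
    by rewrite /value y00 mulr0 addr0.
  split=> //; apply: vP1.
  have -> : evalK X Q = (bi P Q - evalK X P) * Y^-1.
    by rewrite /evalK2 [_ + _ - _]addrC addKr mulfK.
  apply: (@vgeM _ _ _ vP 2 (-1)); last by rewrite vgeE ?invr_eq0 // valV // vY.
  by apply: vgeD => //; apply: vgeN => //; apply: v2.
have val0 z : z ^+ 2 = f.[c] -> value c z P Q = 0.
  move=> zP.
  have [v [vP /(_ fc) vX _ vr]] := place_at_point cover zP two_neq0 sm.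
  have [g vg] := regular_at_uniformizer dP spx vP X0 vX (hol v vP).
  rewrite wE dXsubC => gE.
  have uE' : u = g * Y.
    suff <- : u / Y = g by rewrite divfK.
    apply: scale_inj gE; rewrite -dXsubC.
    exact: (d_uniformizer_neq0 dP spx vP X0 vX).
  have vint A B : vge v 0 (bi A B) by case: (vr A B).
  have YE : Y = bi 0 1 by rewrite /evalK2 evalK0 evalK1 add0r mul1r.
  apply: (vr P Q).2; rewrite -uE -[1]add0r; apply: vgeM => //.
    by rewrite uE' vgeM0 // YE vint.
  rewrite RE evalKM -[1]add0r; apply: vgeM => //; last by rewrite vgeE // vX.
  by rewrite -(evalK2_0 X Y) vint.
have := val0 y0 y0P; have := val0 (- y0); rewrite sqrrN => /(_ y0P).
rewrite /value mulrN => h1 h2.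
have Pc : P.[c] = 0.
  have : P.[c] *+ 2 = 0.
    by rewrite -[RHS]addr0 -{1}h1 -h2 addrACA addNr addr0 mulr2n.
  by rewrite -mulr_natr => /eqP; rewrite mulf_eq0 (negPf two_neq0) orbF => /eqP.
split=> //; move: h2; rewrite Pc add0r => /eqP; rewrite mulf_eq0.
by move: fc; rewrite -y0P expf_eq0 /= => /negPf->; rewrite orbF => /eqP.
Qed.

End HolomorphicOnDoubleCover.

(** * Holomorphic differentials of a hyperelliptic curve *)

Section Reversal.

Variable F : fieldType.

(** x ^ (S - 1) q(1 / x), for q of degree less than S. *)
Definition rev_poly (S : nat) (q : {poly F}) : {poly F} :=
  \poly_(i < S) q`_(S.-1 - i).

Lemma rev_poly_eq0 S (q : {poly F}) : (size q <= S)%N -> rev_poly S q = 0 ->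
  q = 0.
Proof.
move=> sq r0; apply/polyP => i; rewrite coef0.
have [iS|iS] := ltnP i S; last by rewrite nth_default // (leq_trans sq).
have := congr1 (fun r : {poly F} => r`_(S.-1 - i)) r0.
rewrite coef_poly coef0; have -> : (S.-1 - i < S)%N by lia.
by rewrite subKn //; lia.
Qed.

Lemma rev_poly_horner0 S (q : {poly F}) : (0 < S)%N ->
  (rev_poly S q).[0] = q`_S.-1.
Proof. by move=> S0; rewrite horner_coef0 coef_poly S0 subn0. Qed.

Lemma evalK_rev (K : fieldExtType {fraction {poly F}}) (x z : K) S
    (q : {poly F}) :
  x * z = 1 -> (size q <= S)%N ->
  evalK x q * z ^+ S = evalK z (rev_poly S q) * z.
Proof.
move=> xz sq; case: S sq => [|S] sq.
  move: sq; rewrite leqn0 size_poly_eq0 => /eqP->.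
  rewrite /rev_poly (_ : \poly_(i < 0) _ = 0) ?evalK0 ?mul0r //.
  by apply/polyP => i; rewrite coef_poly ltn0 coef0.
rewrite (evalK_sum _ sq) (evalK_sum _ (size_poly _ _)) !mulr_suml.
rewrite (reindex_inj rev_ord_inj); apply: eq_bigr => i _ /=.
rewrite coef_poly ltn_ord subSS /=.
have iS : (i <= S)%N by rewrite -ltnS.
rewrite -!mulrA; congr (_ * _); move: (nat_of_ord i) iS => j jS.
have E : S.+1 = (S - j + j.+1)%N by rewrite addnS subnK.
by rewrite {}E exprD mulrA -exprMn xz expr1n mul1r exprSr.
Qed.

End Reversal.

Section HyperellipticDifferentials.

Variables (F : closedFieldType) (K : fieldExtType {fraction {poly F}}).
Variables (f fr : {poly F}) (n : nat) (x y : K).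
Hypotheses (cover : double_cover f x y) (n_gt0 : (0 < n)%N) (x_neq0 : x != 0).

Let z := x^-1.
Let eta := y * z ^+ n.

Hypothesis frE : evalK z fr = evalK x f * z ^+ (2 * n).

Let xz : x * z = 1. Proof. by rewrite divff. Qed.
Let zx : z * x = 1. Proof. by rewrite mulVf. Qed.
Let z_neq0 : z != 0. Proof. by rewrite invr_eq0. Qed.

(** Reversing polynomials of bounded degree exchanges polynomials in x with
    polynomials in z, up to powers of x. *)
Lemma double_cover_infinity : double_cover fr z eta.
Proof.
have [y2 ind gen] := cover; split.
- by rewrite frE exprMn y2 -exprM mulnC.
- move=> P Q PQ0; pose S := maxn (size P) (size Q).
  have PE : evalK z P * x ^+ S = evalK x (rev_poly S P) * x.
    by apply: evalK_rev => //; rewrite leq_maxl.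
  have QE : evalK z Q * x ^+ S = evalK x (rev_poly S Q) * x.
    by apply: evalK_rev => //; rewrite leq_maxr.
  have [] := ind ('X^n * rev_poly S P) (rev_poly S Q).
    apply: (mulIf x_neq0); rewrite mul0r /evalK2 mulrDl evalKM -mulrA -PE.
    rewrite mulrAC -QE evalKXn evalKX.
    transitivity (x ^+ n * x ^+ S * evalK2 z eta P Q);
      last by rewrite PQ0 mulr0.
    have xzn : x ^+ n * z ^+ n = 1 by rewrite -exprMn xz expr1n.
    rewrite /evalK2 /eta; transitivity (x ^+ n * (evalK z P * x ^+ S)
      + evalK z Q * x ^+ S * y * (x ^+ n * z ^+ n)); first by rewrite xzn mulr1.
    ring.
  move/eqP; rewrite mulf_eq0 (negPf (monic_neq0 (monicXn _ _))) /=.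
  move=> /eqP rP rQ; split.
    by apply: rev_poly_eq0 rP; rewrite leq_maxl.
  by apply: rev_poly_eq0 rQ; rewrite leq_maxr.
- move=> u; have [P [Q [R [R0 uE]]]] := gen u.
  pose S := maxn (size R) (maxn (size P) (size Q)).
  have sz (A : {poly F}) : (size A <= S)%N ->
      evalK x A * z ^+ S = evalK z (rev_poly S A) * z.
    by move=> sA; apply: evalK_rev.
  have sR : (size R <= S)%N by rewrite leq_maxl.
  have sP : (size P <= S)%N by rewrite leq_max leq_maxl orbT.
  have sQ : (size Q <= S)%N by rewrite leq_max leq_maxr orbT.
  exists (rev_poly S P * 'X^n), (rev_poly S Q), (rev_poly S R * 'X^n); split.
    rewrite mulf_eq0 (negPf (monic_neq0 (monicXn _ _))) /= orbF;
      apply: contraNneq R0 => r0.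
    by apply/eqP; exact: rev_poly_eq0 sR r0.
  apply: (mulIf z_neq0); rewrite /evalK2 !evalKM evalKXn evalKX.
  transitivity (u * (evalK z (rev_poly S R) * z) * z ^+ n); first by ring.
  rewrite -sz //; transitivity ((u * evalK x R) * z ^+ S * z ^+ n);
    first by ring.
  rewrite uE /evalK2.
  transitivity ((evalK x P * z ^+ S) * z ^+ n + (evalK x Q * z ^+ S) * eta).
    by rewrite /eta; ring.
  by rewrite !sz //; ring.
Qed.

Variables (Omega : lmodType K) (d : K -> Omega) (dP : is_derivation d).
Variables (p : nat) (charK : p \in [pchar K]).
Hypotheses (spx : p_spans charK x) (dx_neq0 : d x != 0).
Hypothesis two_neq0 : 2%:R != 0 :> F.
Variables a b ar br : {poly F}.
Hypothesis bezout : a * f + b * f^`() = 1.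
Hypothesis bezout_r : ar * fr + br * fr^`() = 1.

Let smooth (g a' b' : {poly F}) c :
  a' * g + b' * g^`() = 1 -> (g.[c] != 0) || (g^`().[c] != 0).
Proof.
move/(congr1 (horner^~ c)); rewrite hornerD !hornerM hornerC => e.
rewrite -negb_and; apply/negP => /andP[/eqP g0 /eqP g'0].
by move/eqP: e; rewrite g0 g'0 !mulr0 addr0 eq_sym oner_eq0.
Qed.

Let y_neq0 : y != 0. Proof. exact: Y_neq0 cover. Qed.
Let eta_neq0 : eta != 0. Proof. by rewrite mulf_neq0 ?expf_neq0. Qed.

Lemma dx_infinity : d x = (- x ^+ 2) *: d z.
Proof.
have : d (x * z) = 0 by rewrite xz -(d_const dP 1) rmorph1.
rewrite (dM dP) => /eqP; rewrite addrC addr_eq0 => /eqP e.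
transitivity (x *: (z *: d x)); first by rewrite scalerA xz scale1r.
by rewrite e scalerN scalerA scaleNr.
Qed.

Lemma differential_infinity u :
  (u / y) *: d x = (- (u * x ^+ 2 * z ^+ n) / eta) *: d z.
Proof.
rewrite dx_infinity scalerA; congr (_ *: _); rewrite /eta.
by field; rewrite y_neq0 expf_neq0.
Qed.

(** A zero of the denominator is also a zero of P and Q, hence can be
    cancelled. *)
Lemma holomorphic_polynomial w u : holomorphic d w -> w = (u / y) *: d x ->
  exists P Q, u = evalK2 x y P Q.
Proof.
move=> hol wE; have [_ _ gen] := cover.
have [P0 [Q0 [R0 [R00 uE0]]]] := gen u.
suff H k : forall R P Q : {poly F}, (size R <= k)%N -> R != 0 ->
    u * evalK x R = evalK2 x y P Q -> exists P Q, u = evalK2 x y P Q.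
  exact: H (leqnn _) R00 uE0.
elim: k => [|k IH] R P Q sR Rn0 uE.
  by move: sR; rewrite leqn0 size_poly_eq0 (negPf Rn0).
have [sR1|sR1] := eqVneq (size R) 1%N.
  move/eqP: sR1 => /size_poly1P [c c0 Rc].
  exists (c^-1%:P * P), (c^-1%:P * Q).
  rewrite /evalK2 !evalKM -mulrA -mulrDr -/(evalK2 x y P Q) -uE Rc !evalKC.
  by rewrite fmorphV mulrC mulfK // constK_eq0.
have [c rc] := closed_rootP _ sR1.
have [Pc Qc] := holomorphic_numerator_root dP spx dx_neq0 cover two_neq0
  (smooth c bezout) hol wE uE (eqP rc).
have /factor_theorem [R1 RE] := rc.
have [P1 PE] : exists P1, P = P1 * ('X - c%:P) by apply/factor_theorem/eqP.
have [Q1 QE] : exists Q1, Q = Q1 * ('X - c%:P) by apply/factor_theorem/eqP.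
have R10 : R1 != 0 by apply: contraNneq Rn0 => r; rewrite RE r mul0r.
apply: (IH R1 P1 Q1) => //.
  by move: sR; rewrite RE size_Mmonic ?monicXsubC // size_XsubC addn2.
have X0 : evalK x ('X - c%:P) != 0.
  by rewrite (evalK_neq0 cover) // polyXsubC_eq0.
apply: (mulIf X0); move: uE; rewrite RE PE QE /evalK2 !evalKM => e.
by rewrite -mulrA e mulrDl mulrAC.
Qed.

(** In the chart at infinity, z ^ (S - 1) (P + Q y) is a combination A + B eta
    of polynomials in z, where A(0) and B(0) are the coefficients of P and Q of
    the highest degrees that S allows. The differential being this combination
    divided by a positive power of z, both must vanish. *)
Lemma holomorphic_degree w P Q S :
  holomorphic d w -> w = (evalK2 x y P Q / y) *: d x ->
  (n <= S)%N -> (size P <= S)%N -> (size Q <= S - n)%N ->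
  P`_S.-1 = 0 /\ ((n < S)%N -> Q`_(S - n).-1 = 0).
Proof.
move=> hol wE nS sP sQ; set M := (S - n)%N in sQ *.
have PE := evalK_rev xz sP; have QE := evalK_rev xz sQ.
have SE : S = (M + n)%N by rewrite subnK.
rewrite differential_infinity in wE.
have cover' := double_cover_infinity.
have [||P0 Q0] := holomorphic_numerator_root dP spx dx_neq0 cover' two_neq0
  (P := - rev_poly S P) (Q := - rev_poly M Q) (R := 'X^(M.+1))
  (smooth 0 bezout_r) hol wE.
- apply: (mulIf z_neq0); rewrite evalKXn evalKX /evalK2 !evalKN.
  transitivity (- (evalK x P * z ^+ S + evalK x Q * z ^+ M * (y * z ^+ n))
      * (x * z) ^+ 2).
    rewrite SE /evalK2 !exprD (exprS z M).
    by move: (z ^+ M) (z ^+ n) => zM zn; ring.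
  by rewrite xz expr1n mulr1 PE QE /eta; ring.
- by rewrite hornerXn expr0n.
move: P0 Q0; rewrite !hornerN => /eqP; rewrite oppr_eq0 => /eqP P0 /eqP.
rewrite oppr_eq0 => /eqP Q0; split.
  by rewrite rev_poly_horner0 // in P0; apply: leq_trans nS.
by move=> nS'; rewrite rev_poly_horner0 // in Q0; rewrite /M subn_gt0.
Qed.

Lemma holomorphic_form w u : holomorphic d w -> w = (u / y) *: d x ->
  exists2 h : {poly F}, (size h <= n.-1)%N & u = evalK x h.
Proof.
move=> hol wE; have [P [Q uE]] := holomorphic_polynomial hol wE.
rewrite uE in wE; have deg := holomorphic_degree hol wE.
have lead (A : {poly F}) : A`_(size A).-1 = 0 -> A = 0.
  by move/eqP; rewrite -lead_coefE lead_coef_eq0 => /eqP.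
have [Q0|Q0] := eqVneq Q 0.
  have uP : u = evalK x P by rewrite uE Q0 evalK2_0.
  exists P => //; rewrite leqNgt; apply/negP => sP.
  have nP : (n <= size P)%N by rewrite -(prednK n_gt0).
  have [] := deg _ nP (leqnn _); first by rewrite Q0 size_poly0.
  by move/lead => P0; move: sP; rewrite P0 size_poly0.
have Q1 : (0 < size Q)%N by rewrite lt0n size_poly_eq0.
have [PQ|PQ] := leqP (size P) (size Q + n).
  have [||_] := deg _ _ PQ; rewrite ?leq_addl ?addnK // => h.
  have := lead Q (h _); rewrite -[X in (X < _)%N]add0n ltn_add2r.
  by move=> /(_ Q1)/eqP; rewrite (negPf Q0).
have [||] := deg (size P) _ (leqnn _).
- by apply: ltnW; apply: leq_ltn_trans PQ; rewrite leq_addl.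
- by rewrite leq_subRL ?(leq_trans (leq_addl _ _) (ltnW PQ)) // addnC ltnW.
by move/lead => P0; move: PQ; rewrite P0 size_poly0.
Qed.

(** At a place where x is not integral, z is, and h(x) dx / y is dz / eta times
    a polynomial in z exactly because deg h <= n - 2. *)
Lemma form_holomorphic (h : {poly F}) : (size h <= n.-1)%N ->
  holomorphic d ((evalK x h / y) *: d x).
Proof.
move=> sh v vP; case: (vP) => _ _ _ [t t0 vt].
suff [g vg ->] : exists2 g, vge v 0 g & (evalK x h / y) *: d x = g *: d t.
  by exists t, g; split=> //; case/orP: vg => [/eqP|]; [left|right].
have [vx|/(vge0V vP) vz] := boolP (vge v 0 x).
  have [g vg gE] := dXoverY_regular dP spx cover vP t0 vt bezout vx.
  exists (evalK x h * g); first by rewrite vgeM0 // vge_evalK.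
  by rewrite -scalerA gE scalerA.
have cover' := double_cover_infinity.
have [g vg gE] := dXoverY_regular dP spx cover' vP t0 vt bezout_r vz.
exists (- evalK z (rev_poly n.-1 h) * g).
  by rewrite vgeM0 // vgeN // vge_evalK.
rewrite differential_infinity -scalerA gE scalerA; congr (((- _) * _) *: _).
transitivity (evalK x h * z ^+ n.-1 * z * x ^+ 2).
  have -> : z ^+ n = z * z ^+ n.-1 by rewrite -exprS prednK.
  by move: (z ^+ n.-1) => zn; ring.
rewrite (evalK_rev xz sh).
transitivity (evalK z (rev_poly n.-1 h) * (x * z) ^+ 2); first by ring.
by rewrite xz expr1n mulr1.
Qed.

End HyperellipticDifferentials.

(** * The function field of the curve *)

Lemma frac_numden (R : idomainType) (u : {fraction R}) :
  exists2 b, b != 0 & exists a, u * FracField.tofrac b = FracField.tofrac a.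
Proof.
elim/quotW: u => r; exists r.2; first exact: denom_ratioP.
exists r.1; unlock FracField.tofrac; rewrite -[LHS]FracField.pi_mul.
apply/eqmodP; rewrite /= FracField.equivfE /FracField.mulf.
by rewrite !numden_Ratio ?(oner_eq0, mulf_neq0, denom_ratioP) // !mulr1 mulrC.
Qed.

Section FunctionField.

Variables (F : fieldType) (K : fieldExtType {fraction {poly F}}).

Local Notation x := (coordx K).

Lemma evalK_coordx (q : {poly F}) : evalK x q = (FracField.tofrac q)%:A.
Proof.
elim/poly_ind: q => [|q c IH]; first by rewrite evalK0 rmorph0 scale0r.
rewrite evalKD evalKM evalKX evalKC IH rmorphD rmorphM scalerDl.
by rewrite mulr_algl /coordx scalerA.
Qed.

(** y is not a rational function of x, because a simple zero c of f would
    have even multiplicity in P ^+ 2 and odd multiplicity in Q ^+ 2 * f. *)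
Lemma sqrt_field_double_cover (f : {poly F}) (y : K) c :
  is_sqrt_function_field f y -> root f c -> f^`().[c] != 0 ->
  double_cover f x y.
Proof.
case=> y2 gen /factor_theorem[f1 fE] f'c.
have f1c : ~~ root f1 c.
  by move: f'c; rewrite fE derivM derivXsubC hornerD !hornerM hornerXsubC subrr
     mulr0 add0r hornerC mulr1.
have f10 : f1 != 0 by apply: contraNneq f1c => ->; rewrite root0.
have y2E : y ^+ 2 = evalK x f by rewrite evalK_coordx.
have evalK_inj q : evalK x q = 0 -> q = 0.
  rewrite evalK_coordx => /eqP; rewrite scaler_eq0 oner_eq0 orbF tofrac_eq0.
  by move/eqP.
have PQ0 (P Q : {poly F}) : P ^+ 2 = Q ^+ 2 * f -> Q = 0.
  move=> e; apply/eqP; apply: contraTT isT => Q0.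
  have f0 : f != 0 by rewrite fE mulf_neq0 ?polyXsubC_eq0.
  have P0 : P != 0.
    have : P ^+ 2 != 0 by rewrite e mulf_neq0 // expf_neq0.
    by rewrite expf_eq0.
  have := congr1 (mup c) e.
  rewrite fE !expr2 !mupM ?mulf_neq0 ?expf_neq0 ?polyXsubC_eq0 //.
  rewrite (mupNroot f1c) -['X - _]expr1 !mup_XsubCX eqxx; lia.
split=> //.
- move=> P Q PQ; have : evalK x (P ^+ 2 - Q ^+ 2 * f) = 0.
    rewrite evalKD evalKN evalKM !evalKXn -y2E -exprMn subr_sqr.
    by rewrite -/(evalK2 x y P Q) PQ mulr0.
  move/evalK_inj/eqP; rewrite subr_eq0 => /eqP/PQ0 Q0; split=> //.
  by apply: evalK_inj; move: PQ; rewrite Q0 evalK2_0.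
- have lin u : exists P Q : {fraction {poly F}}, u = P%:A + Q%:A * y.
    have : u \in <<1; y>>%VS by rewrite gen memvf.
    move=> /(Fadjoin_poly_eq (K := 1%AS)) <-.
    have := @Fadjoin_polyOver _ _ 1%VS y u.
    elim/poly_ind: (Fadjoin_poly _ _ _) => [|A a IH] Aover.
      by exists 0, 0; rewrite horner0 !scale0r mul0r addr0.
    have [|P [Q e]] := IH.
      apply/polyOverP => i.
      have := polyOverP Aover i.+1; by rewrite coefD coefMX coefC addr0.
    have /vlineP [b bE] : a \in <[1]>%VS.
      have := polyOverP Aover 0; by rewrite coefD coefMX coefC add0r.
    exists (Q * FracField.tofrac f + b), P.
    rewrite hornerMXaddC e bE mulrDl -mulrA -expr2 y2 scalerDl.
    rewrite (_ : Q%:A * _ = (Q * FracField.tofrac f)%:A).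
      by rewrite -addrA addrC.
    by rewrite mulr_algl scalerA.
  move=> u; have [P [Q ->]] := lin u.
  have [R1 R10 [A1 e1]] := frac_numden P.
  have [R2 R20 [A2 e2]] := frac_numden Q.
  exists (A1 * R2), (A2 * R1), (R1 * R2); split; first by rewrite mulf_neq0.
  have ev q : evalK x q = in_alg K (FracField.tofrac q) := evalK_coordx q.
  rewrite /evalK2 !evalKM !ev -e1 -e2 !(rmorphM (in_alg K)).
  by rewrite -[P%:A]/(in_alg K P) -[Q%:A]/(in_alg K Q); ring.
Qed.

End FunctionField.

(** * The kernel of the Cartier operator *)

Lemma sum_nat_mul (V : nmodType) (E : nat -> V) N p :
  \sum_(0 <= k < N * p) E k =
  \sum_(0 <= j < N) \sum_(0 <= i < p) E (j * p + i)%N.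
Proof.
elim: N => [|N IH]; first by rewrite !big_geq.
rewrite big_nat_recr //= -IH mulSn addnC.
rewrite (@big_cat_nat _ _ _ (N * p)%N) ?leq_addr //=; congr (_ + _).
rewrite -[X in index_iota X _]add0n big_addn addKn.
by apply: eq_big_nat => i _; rewrite addnC.
Qed.

Section CartierKernel.

Variables (F : fieldType) (K : fieldExtType {fraction {poly F}}).
Variables (p : nat) (pF : p \in [pchar F]).
Hypothesis perfect : forall c : F, exists b, b ^+ p = c.

Lemma pchar_function_field : p \in [pchar K].
Proof. exact: rmorph_pchar (@constK F K) _ pF. Qed.

Let charK := pchar_function_field.
Let p_gt0 : (0 < p)%N := prime_gt0 (pcharf_prime pF).

Lemma poly_proot (q : {poly F}) :
  exists r : {poly F}, map_poly (pFrobenius_aut pF) r = q.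
Proof.
elim/poly_ind: q => [|q c [r rE]]; first by exists 0; rewrite map_poly0.
have [b bE] := perfect c; exists (r * 'X + b%:P).
by rewrite rmorphD rmorphM /= map_polyX map_polyC /= pFrobenius_autE rE bE.
Qed.

Lemma evalK_peval (x : K) (r : {poly F}) :
  evalK x (map_poly (pFrobenius_aut pF) r) =
  peval charK x (map_poly (@constK F K) r).
Proof.
rewrite /evalK /peval -!map_poly_comp; congr (_.[_]).
by apply: eq_map_poly => c /=; rewrite !pFrobenius_autE rmorphXn.
Qed.

Variables (f : {poly F}) (x y : K) (cover : double_cover f x y).
Variables (q : nat) (pq : p = q.*2.+1).

Let y_neq0 : y != 0. Proof. exact: Y_neq0 cover. Qed.
Let y2 : y ^+ 2 = evalK x f. Proof. by case: cover. Qed.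

Lemma y_pexp : y ^+ p = y * evalK x f ^+ q.
Proof. by rewrite pq exprS -mul2n exprM y2. Qed.

(** The field is generated over F(x) by y, and y differs from its p-th power
    by a power of f(x). *)
Lemma double_cover_p_spans : p_spans charK x.
Proof.
move=> u; have [_ _ /(_ u) [P [Q [R [R0 uE]]]]] := cover.
have RK := evalK_neq0 cover R0.
have [r1 r1E] := poly_proot (P * R ^+ p.-1).
have [r2 r2E] := poly_proot (Q * f ^+ q.+1 * R ^+ p.-1).
pose A := (evalK x R)^-1 *: map_poly (@constK F K) r1
  + (evalK x R * y)^-1 *: map_poly (@constK F K) r2.
have [B [C [sC _ CE]]] := peval_mod charK x A.
exists C => //; rewrite {}CE /A pevalD !pevalZ -!evalK_peval r1E r2E !evalKM.
rewrite !evalKXn exprVn; apply: (mulIf RK); rewrite uE /evalK2.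
have Rp : evalK x R ^+ p = evalK x R * evalK x R ^+ p.-1.
  by rewrite -exprS prednK.
rewrite exprVn exprMn y_pexp Rp; rewrite exprSr -y2.
have f0 : evalK x f != 0 by rewrite -y2 expf_neq0.
rewrite -y2 in f0 *.
by field; rewrite RK !expf_neq0 ?y_neq0.
Qed.

Definition residue_class_poly (i : nat) (r : {poly F}) : {poly F} :=
  \poly_(j < size r) r`_(j * p + i).

(** Grouping the exponents of r by their class modulo p gives the coordinates
    on the p-basis. *)
Lemma peval_residue_classes (r : {poly F}) :
  peval charK x (map_poly (@constK F K) r) =
  \sum_(0 <= i < p) evalK x (residue_class_poly i r) ^+ p * x ^+ i.
Proof.
have szr : (size (map_poly (@constK F K) r) <= size r * p)%N.
  by rewrite size_map_poly leq_pmulr.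
rewrite (pevalE _ _ szr) -(big_mkord predT
  (fun k => (map_poly (@constK F K) r)`_k ^+ p * x ^+ k)) sum_nat_mul
    exchange_big_nat.
apply: eq_big_nat => i /andP[_ ip] /=.
rewrite (evalK_sum _ (size_poly _ _)) -(pFrobenius_autE charK) rmorph_sum.
rewrite mulr_suml big_mkord; apply: eq_bigr => j _ /=.
rewrite coef_map coef_poly ltn_ord pFrobenius_autE exprMn -mulrA.
by rewrite exprD exprM.
Qed.

Hypothesis frx : p_free charK x.
Variables (Omega : lmodType K) (d : K -> Omega) (dx_neq0 : d x != 0).

(** As h / y = h f ^ q / y ^ p, the Cartier operator only sees the
    coefficients of the polynomial h f ^ q. *)
Lemma cartier_kernelP (h : {poly F}) :
  cartier d p x ((evalK x h / y) *: d x) 0 <->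
  forall j, (h * f ^+ q)`_(j * p + p.-1) = 0.
Proof.
have [r rE] := poly_proot (h * f ^+ q).
pose g i := evalK x (residue_class_poly i r) / y.
have hyE : evalK x h / y = \sum_(0 <= i < p) g i ^+ p * x ^+ i.
  transitivity (evalK x (h * f ^+ q) / y ^+ p).
    rewrite evalKM evalKXn y_pexp -y2; field.
    by rewrite y_neq0 !expf_neq0.
  rewrite -rE evalK_peval peval_residue_classes mulr_suml;
    apply: eq_big_nat => i _.
  by rewrite expr_div_n mulrAC.
have coefr k : (h * f ^+ q)`_k = r`_k ^+ p by rewrite -rE coef_map.
have gE : g p.-1 = 0 <-> forall j, (h * f ^+ q)`_(j * p + p.-1) = 0.
  split=> [/eqP|h0].
    rewrite mulf_eq0 invr_eq0 (negPf y_neq0) orbF =>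
      /eqP/(evalK_eq0 cover) s0 j.
    rewrite coefr.
    have [jr|jr] := ltnP j (size r).
      have := congr1 (fun A : {poly F} => A`_j) s0;
        rewrite coef_poly jr coef0 => ->.
      by rewrite expr0n gtn_eqF.
    rewrite nth_default ?expr0n ?gtn_eqF //.
    by apply: leq_trans (leq_addr _ _); apply: leq_trans jr (leq_pmulr _ p_gt0).
  rewrite /g (_ : residue_class_poly _ _ = 0) ?evalK0 ?mul0r //.
  apply/polyP => j; rewrite coef0 coef_poly; case: ifP => // _.
  by have := h0 j; rewrite coefr => /eqP; rewrite expf_eq0 => /andP[_ /eqP].
rewrite -gE; split=> [[g' [wE /esym/eqP]]|g0]; last first.
  by exists g; rewrite hyE g0 scale0r.
rewrite scaler_eq0 (negPf dx_neq0) orbF => /eqP g'0.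
have e : \sum_(0 <= i < p) g i ^+ p * x ^+ i
    = \sum_(0 <= i < p) g' i ^+ p * x ^+ i.
  rewrite -hyE; apply/eqP; rewrite -subr_eq0.
  by move/eqP: wE; rewrite -subr_eq0 -scalerBl scaler_eq0 (negPf dx_neq0) orbF.
have : \poly_(i < p) g i - \poly_(i < p) g' i = 0.
  apply: frx.
    by rewrite (leq_trans (size_polyD _ _)) // size_polyN geq_max !size_poly.
  rewrite pevalB !(@pevalE _ _ charK _ _ p) ?size_poly //.
  apply/eqP; rewrite subr_eq0; apply/eqP.
  rewrite !big_mkord in e.
  by under eq_bigr do rewrite coef_poly ltn_ord;
     under [RHS]eq_bigr do rewrite coef_poly ltn_ord.
move/eqP; rewrite subr_eq0 => /eqP/(congr1 (fun A : {poly K} => A`_p.-1)).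
by rewrite !coef_poly ltn_predL p_gt0 g'0.
Qed.

End CartierKernel.

(** * Counting monomials *)

Lemma bin_pchar_neq0 (F : fieldType) p q a : p \in [pchar F] ->
  (q < p)%N -> (a <= q)%N -> 'C(q, a)%:R != 0 :> F.
Proof.
move=> pF qp aq; have p_pr := pcharf_prime pF.
have fact0 n : (n < p)%N -> n`!%:R != 0 :> F.
  elim: n => [|n IH] np; first by rewrite fact0 oner_eq0.
  rewrite factS natrM mulf_neq0 ?IH ?(ltnW np) //.
  by rewrite -(dvdn_pcharf pF) gtnNdvd.
have : ('C(q, a) * (a`! * (q - a)`!))%:R != 0 :> F by rewrite bin_fact // fact0.
by rewrite natrM mulf_eq0 negb_or => /andP[].
Qed.

(** In h (X ^ m + 1) ^ q with m = s p - 1, the exponents i + m a that are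
    congruent to -1 modulo p are those with i + 1 = a + l p; since l < s, the
    exponent (s a + l) p - 1 determines a and l. *)
Lemma coef_binomial_power (F : fieldType) p s q (h : {poly F}) :
  p \in [pchar F] -> (q < p)%N -> (0 < s)%N -> (size h < s * p)%N ->
  (forall j, (h * ('X^(s * p - 1) + 1) ^+ q)`_(j * p + p.-1) = 0) <->
  (forall i, (i.+1 %% p <= q)%N -> h`_i = 0).
Proof.
move=> pF qp s0 sh; have p0 := prime_gt0 (pcharf_prime pF).
set m := (s * p - 1)%N.
have mE : m.+1 = (s * p)%N by rewrite /m subn1 prednK // muln_gt0 s0.
have coefE k : (h * ('X^m + 1) ^+ q)`_k =
    \sum_(a < q.+1) (if (k < m * a)%N then 0 else h`_(k - m * a)) *+ 'C(q, a).
  rewrite addrC exprDn mulr_sumr coef_sum; apply: eq_bigr => a _.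
  by rewrite expr1n mul1r mulrnAr coefMn -exprM coefMXn.
split=> [H i|H j].
- set a := (i.+1 %% p)%N; set l := (i.+1 %/ p)%N => aq.
  have iE : i.+1 = (l * p + a)%N by exact: divn_eq.
  have [ih|] := ltnP i (size h); last exact: nth_default.
  have ls : (l < s)%N by rewrite ltn_divLR //; apply: leq_ltn_trans ih sh.
  have kpos : (0 < s * a + l)%N.
    by move: iE; case: (l) (a) => [|l'] [|a'] //;
      rewrite ?addnS ?muln_gt0 //=; nia.
  have := H (s * a + l).-1; rewrite coefE.
  have -> : ((s * a + l).-1 * p + p.-1 = i + m * a)%N by nia.
  rewrite (bigD1 (inord a)) //= inordK ?ltnS // ltnNge leq_addl /= addnK.
  rewrite big1 ?addr0 => [|b].
    move/eqP; rewrite -mulr_natr mulf_eq0 (negPf (bin_pchar_neq0 pF qp aq))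
      orbF.
    by move/eqP.
  move=> bNa; case: ifP => [_|kb]; first by rewrite mul0rn.
  rewrite nth_default ?mul0rn //.
  have shm : (size h <= m)%N by rewrite -ltnS mE.
  have step u v : (u < v)%N -> (m * u + m <= m * v)%N.
    by move=> uv; rewrite -mulnSr leq_mul2l uv orbT.
  have ba : (b < a)%N.
    rewrite ltnNge leq_eqVlt; apply/negP => /orP[/eqP e|/step ab].
      by case/negP: bNa; apply/eqP/val_inj; rewrite /= inordK ?ltnS.
    by move/negbT: kb; rewrite -leqNgt => kb; clear -kb ab shm ih; lia.
  move/step: ba => ba; apply: leq_trans shm _.
  have := leq_sub2r (m * b) ba; rewrite addKn => /leq_trans; apply.
  by rewrite leq_sub2r // leq_addl.
- rewrite coefE big1 // => a _.
  case: ifP => [_|/negbT]; first by rewrite mul0rn.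
  rewrite -leqNgt => ka; rewrite H ?mul0rn //.
  have aq : (a <= q)%N by rewrite -ltnS.
  have e : ((j * p + p.-1 - m * a).+1 + s * a * p = j.+1 * p + a)%N.
    have Tk : (m * a + a = s * a * p)%N by rewrite addnC -mulSn mE mulnAC.
    rewrite -Tk mulSn; move: (m * a)%N (j * p)%N (nat_of_ord a) ka => u v w uv.
    by clear -uv p0; lia.
  rewrite -(modnMDl (s * a)) addnC e modnMDl modn_small //.
  exact: leq_ltn_trans aq qp.
Qed.

(** A full period contains q residues above q, and an initial segment of at
    most q + 1 residues contains none. *)
Lemma count_residues q k r :
  count (fun i => q < i %% q.*2.+1)%N (iota 0 (k * q.*2.+1 + minn r q.+1))
  = (k * q)%N.
Proof.
set p := q.*2.+1; have p0 : (0 < p)%N by [].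
have block l n : count (fun i => q < i %% p)%N (iota (l * p) n)
    = count (fun i => q < i %% p)%N (iota 0 n).
  rewrite -[(l * p)%N]addn0 iotaDl count_map; apply: eq_count => i /=.
  by rewrite modnMDl.
have low r' : (r' <= q.+1)%N -> count (fun i => q < i %% p)%N (iota 0 r') = 0%N.
  move=> rq; apply/eqP; rewrite -leqn0 leqNgt -has_count; apply/hasPn => i.
  rewrite mem_iota => /andP[_ ir]; rewrite -leqNgt modn_small /p; lia.
have full : count (fun i => q < i %% p)%N (iota 0 p) = q.
  have pE : p = (q.+1 + q)%N by rewrite /p; lia.
  rewrite [X in iota _ X]pE iotaD count_cat low // !add0n.
  rewrite (eq_in_count (a2 := predT)) ?count_predT ?size_iota // => i.
  by rewrite mem_iota -pE => /andP[qi ip]; rewrite modn_small // qi.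
rewrite iotaD count_cat add0n block (low (minn _ _)) ?geq_minr // addn0.
elim: k => [|k IH]; first by rewrite mul0n.
by rewrite mulSn addnC iotaD count_cat IH add0n block full mulSn addnC.
Qed.

(** The monomials X ^ i with i < n - 1 and (i + 1) mod p > q are a basis of the
    polynomials h for which h(x) dx / y is a holomorphic differential killed by
    the Cartier operator. *)
Lemma a_number_count (F : closedFieldType) (p s n q : nat)
    (K : fieldExtType {fraction {poly F}}) (y : K)
    (Omega : lmodType K) (d : K -> Omega) :
  p \in [pchar F] -> p = q.*2.+1 -> (0 < s)%N -> (0 < n)%N ->
  (2 * n = s * p - 1 \/ 2 * n = s * p)%N ->
  (0 < s * p - 1)%N ->
  is_sqrt_function_field ('X^(s * p - 1) + 1) y -> is_kahler d ->
  a_number_is d p (count (fun i => q < i %% p)%N (iota 0 n)).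
Proof.
move=> pF pq s0 n0 nE m0 hK hd; set m := (s * p - 1)%N in hK m0 nE *.
have p_pr := pcharf_prime pF; have p0 := prime_gt0 p_pr.
have mE : m.+1 = (s * p)%N by rewrite /m subn1 prednK // muln_gt0 s0.
have m1 : m%:R = -1 :> F.
  apply/eqP; rewrite -addr_eq0 natr1 mE natrM (pcharf0 pF) mulr0 //.
have q0 : (0 < q)%N.
  by case: q pq => // pq1; move: p_pr; rewrite pq1.
have two0 : 2%:R != 0 :> F.
  rewrite -(dvdn_pcharf pF) gtnNdvd //; lia.
set f : {poly F} := 'X^m + 1 in hK.
have f' : f^`() = - 'X^(m.-1).
  by rewrite derivD derivXn derivC addr0 -mulr_natr -polyC_natr m1 rmorphN1
    mulrN1.
have bezout : 1 * f + 'X * f^`() = 1.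
  by rewrite f' mul1r mulrN -exprS prednK // addrAC subrr add0r.
have [c cE] := @closed_root_exists F m (-1) m0.
have rc : root f c by rewrite rootE !hornerE cE addNr.
have f'c : f^`().[c] != 0.
  rewrite f' hornerN hornerXn oppr_eq0; apply/eqP => e.
  move/eqP: cE; by rewrite -(prednK m0) exprS e mulr0 eq_sym oppr_eq0 oner_eq0.
set x := coordx K.
have cover : double_cover f x y := sqrt_field_double_cover hK rc f'c.
have perfect (b : F) : exists a, a ^+ p = b by exact: closed_root_exists.
have charK := pchar_function_field K pF.
have spx : p_spans charK x by have := double_cover_p_spans pF perfect cover pq.
have x0 : x != 0.
  have := evalK_neq0 cover (negbT (polyX_eq0 F)).
  by rewrite evalKX.
have frx : p_free charK x.
  have f0 : f.[0] = 1 by rewrite !hornerE expr0n gtn_eqF // add0r.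
  have f0n : f.[0] != 0 by rewrite f0 oner_eq0.
  have [z zE] := @closed_root_exists F 2 f.[0] isT.
  have [|v [vP /(_ f0n) vx _ _]] := place_at_point cover zE two0;
    first by rewrite f0n.
  by move: vx; rewrite subr0 evalKX => vx; exact: (uniformizer_p_free vP x0 vx).
have dP : is_derivation d by case: hd.
have dx0 : d x != 0 := kahler_d_neq0 perfect hd spx frx.
(* z ^ (2 n) f(1 / z) is 1 + z ^ m for m = 2 n and z + z ^ (m + 1) for
   m = 2 n - 1; in the latter case its derivative is 1. *)
pose e := (2 * n - m)%N.
pose fr : {poly F} := 'X^e * (1 + 'X^m).
have frE : evalK x^-1 fr = evalK x f * x^-1 ^+ (2 * n).
  rewrite /fr /f evalKM !evalKD !evalKXn !evalKX !evalK1.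
  have -> : (2 * n = m + e)%N by rewrite /e subnKC //; lia.
  rewrite exprD [RHS]mulrA mulrDl -exprMn divff // expr1n mul1r; ring.
have [ar [br bezout_r]] : exists ar br, ar * fr + br * fr^`() = 1.
  rewrite /fr /e; case: nE => ->.
    exists 1, 'X; rewrite subnn expr0 !mul1r [1 + 'X^m]addrC -/f.
    by rewrite -[X in X + _]mul1r.
  exists 0, 1; rewrite mul0r add0r mul1r -mE subSnn mulrDr mulr1 -exprD add1n.
  rewrite derivD !derivXn expr0 mulr1n -mulr_natr -polyC_natr mE natrM.
  by rewrite (pcharf0 pF) mulr0 mulr0 addr0.
pose idx := [seq i <- iota 0 n.-1 | (q < i.+1 %% p)%N].
have -> : count (fun i => q < i %% p)%N (iota 0 n) = size idx.
  rewrite size_filter -{1}(prednK n0) /= mod0n add0n -[1%N]addn0 iotaDl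
    count_map.
  exact: eq_count.
have idxP i : (i \in idx) = (q < i.+1 %% p)%N && (i < n.-1)%N.
  by rewrite mem_filter mem_iota.
have idxU : uniq idx by rewrite filter_uniq // iota_uniq.
pose ex (j : 'I_(size idx)) := nth 0%N idx j.
have ex_in j : ex j \in idx by rewrite mem_nth.
pose H (c' : 'I_(size idx) -> F) := \sum_j (c' j)%:P * 'X^(ex j).
have coefH c' i : (H c')`_i = \sum_j c' j * (i == ex j)%:R.
  by rewrite coef_sum; apply: eq_bigr => j _; rewrite coefCM coefXn.
have coefH_ex c' j : (H c')`_(ex j) = c' j.
  rewrite coefH (bigD1 j) //= eqxx mulr1 big1 ?addr0 // => k kj.
  by rewrite nth_uniq // eq_sym (inj_eq val_inj) (negPf kj) mulr0.
have coefH_out c' i : i \notin idx -> (H c')`_i = 0.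
  move=> iN; rewrite coefH big1 // => j _.
  by rewrite (negPf (contraNneq _ iN)) ?mulr0 // => ->.
have combE c' : \sum_j constK K (c' j) *: ((evalK x 'X^(ex j) / y) *: d x)
    = (evalK x (H c') / y) *: d x.
  have -> : evalK x (H c') = \sum_j constK K (c' j) * evalK x 'X^(ex j).
    rewrite /H; elim/big_ind2: _ => [|A B C D <- <-|j _]; first exact: evalK0.
      exact: evalKD.
    by rewrite evalKM evalKC.
  rewrite mulr_suml scaler_suml; apply: eq_bigr => j _.
  by rewrite scalerA mulrA.
have y0 : y != 0 := Y_neq0 cover.
exists (fun j => (evalK x 'X^(ex j) / y) *: d x); split=> [c'|w].
  rewrite combE => /eqP; rewrite scaler_eq0 (negPf dx0) orbF mulf_eq0 invr_eq0.
  rewrite (negPf y0) orbF => /eqP/(evalK_eq0 cover) H0 j.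
  by rewrite -coefH_ex H0 coef0.
have sHs : (n.-1 < s * p)%N.
  rewrite prednK //; apply: leq_trans (leq_pmull n (ltn0Sn 1)) _.
  by case: nE => ->; rewrite -mE ?leqnSn.
have kerE (h : {poly F}) : (size h <= n.-1)%N ->
    cartier d p x ((evalK x h / y) *: d x) 0 <->
    (forall i, (i.+1 %% p <= q)%N -> h`_i = 0).
  move=> sh; have qp : (q < p)%N by rewrite pq ltnS -addnn leq_addr.
  have := coef_binomial_power pF qp s0 (leq_ltn_trans sh sHs).
  by apply: iff_trans; apply: cartier_kernelP.
split=> [[hol cart]|[c' ->]].
  have [u wE] : exists u, w = (u / y) *: d x.
    case: cart => g [-> _]; eexists (_ * y); by rewrite mulfK.
  have [h sh uE] := holomorphic_form cover n0 x0 frE dP spx dx0 two0 bezout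
    bezout_r hol wE.
  rewrite wE uE in cart *.
  have hz := (kerE h sh).1 cart.
  exists (fun j => h`_(ex j)); rewrite combE; congr ((evalK x _ / y) *: d x).
  apply/polyP => i; have [iI|iN] := boolP (i \in idx).
    have [j <-] : exists j, ex j = i.
      have ij : (index i idx < size idx)%N by rewrite index_mem.
      by exists (Ordinal ij); rewrite /ex nth_index.
    by rewrite coefH_ex.
  rewrite coefH_out //; move: iN; rewrite idxP negb_and -!leqNgt =>
    /orP[/hz //|ni].
  by rewrite nth_default // (leq_trans sh).
rewrite combE; have sH : (size (H c') <= n.-1)%N.
  apply/leq_sizeP => i ni; apply: coefH_out.
  by rewrite idxP negb_and -!leqNgt ni orbT.
split; first exact: (form_holomorphic cover n0 x0 frE dP spx bezout bezout_r).
apply: (kerE _ sH).2 => i iq; apply: coefH_out.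
by rewrite idxP negb_and -!leqNgt iq.
Qed.

Theorem theorem3p2 (F : closedFieldType) (p s : nat)
    (hp : p \in [pchar F]) (hp2 : (2 < p)%N) (hs : (1 <= s)%N)
    (K : fieldExtType {fraction {poly F}}) (y : K)
    (hK : is_sqrt_function_field ('X^(s * p - 1) + 1) y)
    (Omega : lmodType K) (d : K -> Omega) (hd : is_kahler d) :
  (forall k : nat, s = (2 * k + 1)%N ->
     a_number_is d p ((k * (p - 1)) %/ 2)) /\
  (forall k : nat, (1 <= k)%N -> s = (2 * k)%N ->
     a_number_is d p ((k * (p - 1)) %/ 2)).
Proof.
have [q pq] : exists q, p = q.*2.+1.
  exists p./2; have [p2|po] := even_prime (pcharf_prime hp);
    first by rewrite p2 in hp2.
  by rewrite -[LHS]odd_double_half po.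
have q0 : (0 < q)%N by lia.
have dimE k : ((k * (p - 1)) %/ 2 = k * q)%N.
  by rewrite pq subn1 /= -muln2 mulnA mulnK.
have m0 : (0 < s * p - 1)%N.
  by rewrite subn_gt0 (leq_trans (ltnW hp2)) // leq_pmull.
split=> [k sE|k k1 sE].
  have n0 : (0 < k * p + q)%N by rewrite addn_gt0 q0 orbT.
  have nE : (2 * (k * p + q) = s * p - 1)%N by rewrite sE pq; lia.
  have := a_number_count hp pq hs n0 (or_introl nE) m0 hK hd.
  by rewrite dimE pq -(count_residues q k q) (minn_idPl _).
have n0 : (0 < k * p)%N by rewrite muln_gt0 k1 (prime_gt0 (pcharf_prime hp)).
have nE : (2 * (k * p) = s * p)%N by rewrite sE mulnA.
have := a_number_count hp pq hs n0 (or_intror nE) m0 hK hd.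
by rewrite dimE pq -(count_residues q k 0) min0n addn0.
Qed.
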